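(* Let $A:=(V,m_2)$ be a strictly graded commutative algebra and let $m$ and $m'$ be two minimal $C_{n+1}$-structures on $V$ whose underlying algebra is $A$. Let $\phi\in\mathcal M_n(\bar m;\bar m')$ be an extendable $C_n$-morphism. Then $H^{n-1,1}_{\mathrm{Harr}}(A,A)$ acts freely and transitively on $\mathcal{EM}_n(\phi:m,m')$ by $$H^{n-1,1}_{\mathrm{Harr}}(A,A)\times\mathcal{EM}_n(\phi:m,m')\to\mathcal{EM}_n(\phi:m,m'),\qquad(\xi,\gamma)\mapsto\gamma+\xi.$$
   Context: Conventions. $\mathbb K$ is an evenly graded commutative ring containing $\mathbb Q$; modules are graded $\mathbb K$-modules, cohomologically graded, with the Koszul sign rule. $(\Sigma V)^i=V^{i+1}$, $(\Sigma^{-1}V)^i=V^{i-1}$; $\Sigma V^*$ means $\mathrm{Hom}_{\mathbb K}(\Sigma V,\mathbb K)$. Profinite modules are inverse limits of free modules of finite rank. For $W$ profinite, $\widehat TW=\prod_{i\ge0}W^{\hat\otimes i}$ and $\widehat LW\subset\widehat TW$ is the Lie subalgebra of convergent (possibly infinite) linear combinations of Lie monomials. Vector field = continuous derivation; diffeomorphism = invertible continuous homomorphism; $\mathrm{Der}(X)$, $\mathrm{Aut}(X)$ are the Lie algebra and group of these. Elements of $W^{\hat\otimes n}$ have order $n$; an endomorphism of $\widehat LW$ has order $n$ if it takes elements of order $i$ to elements of order $i+n-1$. $(n)$ denotes the module of continuous endomorphisms of $\widehat L\Sigma V^*$ of order $\ge n$. A diffeomorphism is pointed if it is of the form $\mathrm{id}+\phi_2+\phi_3+\cdots$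 with $\phi_i$ an endomorphism of order $i$. Minimal $C_n$-structures. Let $V$ be a free graded module, $n\ge3$. A minimal $C_n$-structure on $V$ is a vector field $m\in\mathrm{Der}(\widehat L\Sigma V^* )$ of degree one of the form $m=m_2+\dots+m_{n-1}$, $m_i$ of order $i$, with $m^2=0\mod(n+1)$. Its part $m_2$ determines a strictly graded commutative algebra $(V,m_2)$, the underlying algebra; conversely strictly graded commutative algebra structures on $V$ are given by vector fields $m_2$ of order 2 and degree one with $m_2^2=0$. For a minimal $C_{n+1}$-structure $m=m_2+\dots+m_n$, $\bar m:=m_2+\dots+m_{n-1}$ is the corresponding $C_n$-structure. Morphisms. A minimal $C_n$-morphism from $m$ to $m'$ (minimal $C_n$-structures on $V$) is a diffeomorphism $\phi\in\mathrm{Aut}(\widehat L\Sigma V^* )$ of degree zero with $\phi\circ m=m'\circ\phi\mod(n)$. Two such morphisms $\phi,\phi'$ are homotopic if there is a vector field $\eta$ of degree $-1$ with $\phi=\phi'\circ\exp([m,\eta])\mod(n-1)$. $\mathcal M_n(m;m')$, for $m,m'$ with the same underlying algebra, is the set of pointed minimal $C_n$-morphisms from $m$ to $m'$ modulo homotopy. For minimal $C_{n+1}$-structures $m,m'$ with the same underlying algebra, a pointed $C_n$-morphism $\phi$ from $\bar m$ to $\bar m'$ is extendable if there is a vector field $\gamma$ of order $n-1$ and degree zero such that $\exp(\gamma)\circ\phi$ is a $C_{n+1}$-morphism from $m$ to $m'$; $\gamma$ is called an extension of $\phi$. Two extensions $\gamma,\gamma'$ of $\phi$ are equivalent if there is a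 vector field $\eta$ of order $n-2$ and degree $-1$ with $\exp(\gamma)\circ\phi=\exp(\gamma')\circ\phi\circ\exp([m,\eta])\mod(n)$. $\mathcal{EM}_n(\phi:m,m')$ is the set of extensions of $\phi$ modulo equivalence. Harrison cohomology. $C^\bullet_{\mathrm{Harr}}(A,A)=\Sigma^{-1}\mathrm{Der}(\widehat L\Sigma V^* )$ with differential $\xi\mapsto[m_2,\xi]$; $\xi$ has bidegree $(i,j)$ if it is a vector field of order $i$ and has degree $j$ in $\Sigma^{-1}\mathrm{Der}$ (i.e. degree $j-1$ as a vector field). The differential has bidegree $(1,1)$, and $H^{ij}_{\mathrm{Harr}}(A,A)$ is the resulting bigraded cohomology. *)

(* Defs.v *)
From HB Require Import structures.
From mathcomp Require Import all_boot all_order all_algebra.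
From mathcomp Require Import all_classical zify.

Set Implicit Arguments.
Unset Strict Implicit.
Unset Printing Implicit Defensive.

Import GRing.Theory.
Local Open Scope ring_scope.

(* An evenly graded commutative ring K containing the rationals: the grading is
   an internal direct sum decomposition of the total ring. As it is even, K is
   commutative in the ungraded sense and scalars never produce Koszul signs. *)
Record evenGrading (K : comUnitRingType) := EvenGrading {
  gr :> int -> set K;
  gr0 : forall i, gr i 0;
  grB : forall i x y, gr i x -> gr i y -> gr i (x - y);
  gr_1 : gr 0 1;
  grM : forall i j x y, gr i x -> gr j y -> gr (i + j) (x * y);
  gr_odd : forall i x, odd `|i|%N -> gr i x -> x = 0;
  gr_span : forall x, exists (s : seq int) (c : int -> K),
    (forall i, gr i (c i)) /\ x = \sum_(i <- s) c i;
  gr_free : forall (s : seq int) (c : int -> K), uniq s ->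
    (forall i, gr i (c i)) -> \sum_(i <- s) c i = 0 ->
    forall i, i \in s -> c i = 0;
  gr_rat : exists q : {rmorphism rat -> K}, injective q }.

(* Lie monomials in generators x_i, i : I. *)
Inductive lieTree (I : Type) :=
  | LieGen of I
  | LieBr of lieTree I & lieTree I.

HB.instance Definition _ (I : Type) := gen_eqMixin (lieTree I).
HB.instance Definition _ (I : Type) := gen_choiceMixin (lieTree I).

Section LieSeries.
Context {K : comUnitRingType} (G : evenGrading K) {I : choiceType}.

(* V is the free graded module with homogeneous basis (e_i), e_i in V^(dg i).
   Then Sigma V^* = Hom(Sigma V, K) is the product of the K x_i, where (x_i) is
   the dual basis; e_i has degree dg i - 1 in Sigma V, hence |x_i| = 1 - dg i. *)
Variable dg : I -> int.

Definition wdeg (w : seq I) : int := \sum_(i <- w) (1 - dg i).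

(* W = Sigma V^*: the word [:: i_1; ..; i_n] stands for the monomial
   x_{i_1} (x) .. (x) x_{i_n}, so the n-fold completed tensor power of W is the
   module of K-valued functions on words of length n, and an element of the
   completed tensor algebra is given by its coefficients on all words. *)
Definition nseries : Type := seq I -> K^o.
HB.instance Definition _ := GRing.Lmodule.on nseries.
Implicit Types f g : nseries.

Definition homog (p : int) f := forall w, G (p - wdeg w) (f w).

Definition koszul (z : int) : K := (-1) ^+ `|z|%N.

Definition tmul f g : nseries :=
  fun w => \sum_(k < (size w).+1) (f (take k w) : K) * g (drop k w).

(* The graded commutator in the tensor algebra. Since K is even, the sign of a
   product of monomials depends only on the degrees of the words; see brE. *)
Definition br f g : nseries := fun w =>
  \sum_(k < (size w).+1)
    ((f (take k w) : K) * g (drop k w) -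
     koszul (wdeg (take k w) * wdeg (drop k w)) *
       ((g (take k w) : K) * f (drop k w))).

Fixpoint lieMon (t : lieTree I) : nseries :=
  match t with
  | LieGen i => fun w => if w == [:: i] then 1 else 0
  | LieBr a b => br (lieMon a) (lieMon b)
  end.

(* f is the sum of the family (c t * t) indexed by all Lie monomials t; the
   topology is that of the inverse limit (product of copies of the discrete K),
   so the family converges iff it is finite in each coordinate. *)
Definition lie_sum (c : lieTree I -> K) f := forall w,
  exists s : seq (lieTree I), [/\ uniq s,
    forall t, t \notin s -> c t * lieMon t w = 0
    & f w = \sum_(t <- s) c t * lieMon t w].

Definition is_lie f := exists c, lie_sum c f.

(* A graded module is the direct sum of its homogeneous components. *)
Definition lhat_pred : {pred nseries} := fun f =>
  `[< exists s : seq nseries,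
        (forall g, g \in s -> is_lie g /\ exists p, homog p g)
        /\ f = \sum_(g <- s) g >].

Lemma koszul_odd (z : int) : koszul z = if odd `|z|%N then -1 else 1.
Proof. by rewrite /koszul -signr_odd; case: odd. Qed.

Lemma nseries_sumE (J : Type) (s : seq J) (F : J -> nseries) w :
  (\sum_(j <- s) F j) w = \sum_(j <- s) (F j w : K).
Proof. by elim/big_rec2: _ => // j y z _ <-. Qed.

Lemma grN i x : G i x -> G i (- x).
Proof. by move=> Gx; rewrite -[- x]add0r; apply: grB => //; apply: gr0. Qed.

Lemma grD i x y : G i x -> G i y -> G i (x + y).
Proof. by move=> Gx Gy; rewrite -[y]opprK; apply: grB => //; apply: grN. Qed.

Lemma gr_sum i (J : Type) (r : seq J) (F : J -> K) :
  (forall j, G i (F j)) -> G i (\sum_(j <- r) F j).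
Proof. by move=> GF; elim/big_rec: _ => [|j x _ Gx]; [exact: gr0|exact: grD]. Qed.

Lemma gr_sign i z x : G i x -> G i (koszul z * x).
Proof. by rewrite koszul_odd; case: odd; rewrite ?mulN1r ?mul1r //; apply: grN. Qed.

Lemma wdeg_cat u v : wdeg (u ++ v) = wdeg u + wdeg v.
Proof. by rewrite /wdeg big_cat. Qed.

Lemma homog_br p q f g : homog p f -> homog q g -> homog (p + q) (br f g).
Proof.
move=> hf hg w; apply: gr_sum => k.
have E : wdeg w = wdeg (take k w) + wdeg (drop k w) by rewrite -wdeg_cat cat_take_drop.
apply: grB.
  have -> : p + q - wdeg w = (p - wdeg (take k w)) + (q - wdeg (drop k w)).
    by rewrite E opprD addrACA.
  exact: grM.
apply: gr_sign.
have -> : p + q - wdeg w = (q - wdeg (take k w)) + (p - wdeg (drop k w)).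
  by rewrite E opprD [p + q]addrC addrACA.
exact: grM.
Qed.

Lemma homog0_odd p f w : homog p f -> odd `|p - wdeg w|%N -> f w = 0.
Proof. by move=> hf o; exact: (gr_odd o (hf w)). Qed.

Lemma odd_absB (a b : int) : odd `|(a - b)%R|%N = odd `|a|%N (+) odd `|b|%N.
Proof. lia. Qed.

Lemma brE p q f g : homog p f -> homog q g ->
  br f g = tmul f g - koszul (p * q) *: tmul g f.
Proof.
move=> hf hg; apply/funext => w.
rewrite /br /tmul /GRing.add /= /GRing.opp /= /GRing.scale /=.
rewrite /GRing.scale /= mulr_sumr -sumrB; apply: eq_bigr => k _; congr (_ - _).
set u := take k w; set v := drop k w.
have [o|] := boolP (odd `|(q - wdeg u)%R|%N).
  by rewrite (homog0_odd hg o) !mul0r !mulr0.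
have [o _|] := boolP (odd `|(p - wdeg v)%R|%N).
  by rewrite (homog0_odd hf o) !mulr0.
rewrite !odd_absB => pv qu; congr (_ * _).
rewrite !koszul_odd !abszM !oddM.
by case: (odd `|p|) (odd `|q|) (odd `|wdeg u|) (odd `|wdeg v|) pv qu => [] [] [] [].
Qed.

Lemma sum_extend (s s' : seq (lieTree I)) (F : lieTree I -> K) :
  uniq s -> uniq s' -> {subset s <= s'} ->
  (forall t, t \notin s -> F t = 0) -> \sum_(t <- s') F t = \sum_(t <- s) F t.
Proof.
move=> us us' ss' F0; rewrite (bigID (mem s)) /= [X in _ + X]big1 ?addr0; last first.
  by move=> t /F0.
rewrite -big_filter; apply: perm_big; apply: uniq_perm => //.
  exact: filter_uniq.
by move=> t; rewrite mem_filter; case: (boolP (t \in s)) => //= /ss' ->.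
Qed.

Lemma lie_sum_unif c f (ws : seq (seq I)) : lie_sum c f ->
  exists s : seq (lieTree I), forall s', uniq s' -> {subset s <= s'} ->
  forall u, u \in ws -> (forall t, t \notin s' -> c t * lieMon t u = 0) /\
    f u = \sum_(t <- s') c t * lieMon t u.
Proof.
move=> cf; elim: ws => [|w ws [s IH]]; first by exists [::].
have [s1 [us1 z1 E1]] := cf w; exists (s1 ++ s) => s' us' ss' u.
rewrite inE => /orP[/eqP->|uws]; last first.
  by apply: IH => // t ts; apply: ss'; rewrite mem_cat ts orbT.
have s1s' : {subset s1 <= s'} by move=> t ts; apply: ss'; rewrite mem_cat ts.
split; last by rewrite E1; apply/esym/sum_extend.
by move=> t ts'; apply: z1; apply: contra ts'; apply: s1s'.
Qed.

Lemma is_lie_br f g : is_lie f -> is_lie g -> is_lie (br f g).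
Proof.
move=> [c cf] [d dg']; pose e t := if t is LieBr a b then c a * d b else 0.
exists e => w.
pose ws := [seq take k w | k <- iota 0 (size w).+1] ++
           [seq drop k w | k <- iota 0 (size w).+1].
have tws (k : 'I_(size w).+1) : take k w \in ws.
  by rewrite mem_cat; apply/orP; left; apply/mapP; exists (k : nat); rewrite // mem_iota ltn_ord.
have dws (k : 'I_(size w).+1) : drop k w \in ws.
  by rewrite mem_cat; apply/orP; right; apply/mapP; exists (k : nat); rewrite // mem_iota ltn_ord.
have [sf Hf] := lie_sum_unif ws cf; have [sg Hg] := lie_sum_unif ws dg'.
pose S := undup (sf ++ sg).
have uS : uniq S by apply: undup_uniq.
have fS : {subset sf <= S} by move=> t ts; rewrite mem_undup mem_cat ts.
have gS : {subset sg <= S} by move=> t ts; rewrite mem_undup mem_cat ts orbT.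
have {}Hf := Hf S uS fS; have {}Hg := Hg S uS gS.
have eE a b : e (LieBr a b) * lieMon (LieBr a b) w =
    \sum_(k < (size w).+1)
     ((c a * lieMon a (take k w)) * (d b * lieMon b (drop k w)) -
      koszul (wdeg (take k w) * wdeg (drop k w)) *
      ((d b * lieMon b (take k w)) * (c a * lieMon a (drop k w)))).
  rewrite /= /br mulr_sumr; apply: eq_bigr => k _.
  rewrite mulrBr; congr (_ - _); first by rewrite mulrACA.
  by rewrite mulrCA; congr (_ * _); rewrite [c a * d b]mulrC mulrACA.
exists [seq LieBr a b | a <- S, b <- S]; split.
- by apply: allpairs_uniq => // -[a b] [a' b'] _ _ [-> ->].
- case=> [i _|a b nab]; first by rewrite mul0r.
  rewrite eE; apply: big1 => k _.
  have [aS|aS] := boolP (a \in S); last first.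
    rewrite (proj1 (Hf _ (tws k)) _ aS) (proj1 (Hf _ (dws k)) _ aS).
    by rewrite mul0r !mulr0 subrr.
  have [bS|bS] := boolP (b \in S); last first.
    rewrite (proj1 (Hg _ (tws k)) _ bS) (proj1 (Hg _ (dws k)) _ bS).
    by rewrite mul0r !mulr0 subrr.
  by case/negP: nab; apply/allpairsP; exists (a, b).
rewrite big_allpairs_dep /=.
under eq_bigr => a _ do under eq_bigr => b _ do rewrite eE.
under eq_bigr => a _ do rewrite exchange_big /=.
rewrite exchange_big /=; apply: eq_bigr => k _.
under eq_bigr => a _ do rewrite sumrB.
rewrite sumrB; congr (_ - _).
  rewrite (proj2 (Hf _ (tws k))) (proj2 (Hg _ (dws k))) big_distrlr /=.
  by [].
set z := koszul _.
rewrite (proj2 (Hg _ (tws k))) (proj2 (Hf _ (dws k))) big_distrlr /=.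
rewrite exchange_big /= mulr_sumr; apply: eq_bigr => a _.
by rewrite mulr_sumr.
Qed.

Lemma homogZ p j (k : K) f : G j k -> homog p f -> homog (j + p) (k *: f).
Proof. by move=> Gk hf w; rewrite -addrA; apply: grM => //; apply: hf. Qed.

Lemma is_lieZ (k : K) f : is_lie f -> is_lie (k *: f).
Proof.
move=> [c cf]; exists (fun t => k * c t) => w; have [s [us z E]] := cf w.
exists s; split=> // [t /z|]; first by rewrite -mulrA => ->; rewrite mulr0.
transitivity (k * (f w : K)); first by [].
by rewrite E mulr_sumr; apply: eq_bigr => t _; rewrite mulrA.
Qed.

Lemma lhat_submod : submod_closed lhat_pred.
Proof.
split=> [|k f g]; first by apply/asboolP; exists [::]; rewrite big_nil.
move=> /asboolP[s [hs ->]] /asboolP[s' [hs' ->]]; apply/asboolP.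
have [js [c [Gc kE]]] := gr_span G k.
exists ([seq c j *: h | j <- js, h <- s] ++ s'); split.
  move=> h; rewrite mem_cat => /orP[|/hs'] //.
  move=> /allpairsP[[j h'] /= [_ /hs[lh [p hp]] ->]]; split; first exact: is_lieZ.
  by exists (j + p); apply: homogZ.
rewrite big_cat /=; congr (_ + _); rewrite big_allpairs_dep /= kE scaler_suml.
by apply: eq_bigr => j _; rewrite scaler_sumr.
Qed.
HB.instance Definition _ :=
  GRing.isSubmodClosed.Build K nseries lhat_pred lhat_submod.

Lemma br_suml (J : Type) (s : seq J) (F : J -> nseries) g :
  br (\sum_(j <- s) F j) g = \sum_(j <- s) br (F j) g.
Proof.
apply/funext => w; rewrite nseries_sumE exchange_big; apply: eq_bigr => k _.
rewrite sumrB /= !nseries_sumE mulr_suml; congr (_ - _).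
by rewrite -mulr_sumr -mulr_sumr.
Qed.

Lemma br_sumr (J : Type) (s : seq J) (F : J -> nseries) g :
  br g (\sum_(j <- s) F j) = \sum_(j <- s) br g (F j).
Proof.
apply/funext => w; rewrite nseries_sumE exchange_big; apply: eq_bigr => k _.
rewrite sumrB /= !nseries_sumE mulr_sumr; congr (_ - _).
by rewrite -mulr_sumr -mulr_suml.
Qed.

Lemma lhat_br f g :
  f \in lhat_pred -> g \in lhat_pred -> br f g \in lhat_pred.
Proof.
move=> /asboolP[s [hs ->]] /asboolP[s' [hs' ->]]; apply/asboolP.
exists [seq br h h' | h <- s, h' <- s']; split.
  move=> h /allpairsP[[a b] /= [/hs[la [p hp]] /hs'[lb [q hq]] ->]].
  split; first exact: is_lie_br.
  by exists (p + q); apply: homog_br.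
rewrite big_allpairs_dep /= br_suml; apply: eq_bigr => h _.
by rewrite br_sumr.
Qed.

(* The completed free Lie algebra on W = Sigma V^*. *)
Record lhat := Lhat { lval :> nseries; _ : lval \in lhat_pred }.
HB.instance Definition _ := [isSub for lval].
HB.instance Definition _ := [Choice of lhat by <:].
HB.instance Definition _ := [SubChoice_isSubLmodule of lhat by <:].

Definition lbr (f g : lhat) : lhat := Lhat (lhat_br (valP f) (valP g)).

Definition cvg_lhat (u : nat -> lhat) (f : lhat) :=
  forall w, exists N, forall k, (N <= k)%N -> lval (u k) w = lval f w.

(* Elements of order n, i.e. in the n-fold completed tensor power of W. *)
Definition elt_order (n : nat) (f : lhat) :=
  forall w, size w != n -> lval f w = 0.

Local Notation End := (lhat -> lhat).
Implicit Types X Y : End.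

Definition lhat_continuous X := forall (f : lhat) w, exists S : seq (seq I),
  forall g : lhat, (forall u, u \in S -> lval g u = lval f u) ->
  lval (X g) w = lval (X f) w.

Definition endo X := linear X /\ lhat_continuous X.

Definition has_degree (d : int) X :=
  forall p (f : lhat), homog p f -> homog (p + d) (X f).

(* Elements of order i go to elements of order i + n - 1. *)
Definition has_order (n : nat) X := forall i (f : lhat), elt_order i f ->
  forall w, (size w + 1)%N != (i + n)%N -> lval (X f) w = 0.

(* The module (n) of continuous endomorphisms of order >= n. *)
Definition order_ge (n : nat) X := endo X /\
  forall i (f : lhat), elt_order i f ->
    forall w, (size w + 1 < i + n)%N -> lval (X f) w = 0.

Definition eqmod (n : nat) X Y := order_ge n (X - Y).

(* Vector fields of degree d. *)
Definition vfield (d : int) X := [/\ endo X, has_degree d X &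
  forall p (f g : lhat), homog p f ->
    X (lbr f g) = lbr (X f) g + koszul (d * p) *: lbr f (X g)].

Definition lie_hom X :=
  [/\ endo X, has_degree 0 X & forall f g : lhat, X (lbr f g) = lbr (X f) (X g)].

Definition diffeo X :=
  lie_hom X /\ exists Y, [/\ lie_hom Y, cancel X Y & cancel Y X].

(* Graded commutator of endomorphisms of degrees d and e. *)
Definition gcomm (d e : int) X Y : End :=
  (X \o Y : End) - koszul (d * e) *: (Y \o X : End).

(* exp X f is the sum of the series X^k f / k!, with junk value 0 if the
   series does not converge. *)
Definition vexp X : End := fun f : lhat => xget 0 [set g : lhat |
  cvg_lhat (fun N => \sum_(k < N) ((k`!)%:R^-1 : K) *: iter k X f) g].

(* Strictly graded commutative algebra structures on V. *)
Record scAlgebra := ScAlgebra {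
  mul2 :> End;
  mul2_vfield : vfield 1 mul2;
  mul2_order : has_order 2 mul2;
  mul2_sq : mul2 \o mul2 = 0 }.

(* A minimal C_n-structure m = m_2 + .. + m_(n-1) is given by the family of its
   components m_i, which m determines. Only the indices 2 <= i < n matter, so
   for a C_(n+1)-structure m, the same family seen as a C_n-structure is the
   truncation of m. *)
Definition tot (n : nat) (m : nat -> End) : End := \sum_(2 <= i < n) m i.

Definition minC (n : nat) (m : nat -> End) :=
  (forall i, (2 <= i < n)%N -> vfield 1 (m i) /\ has_order i (m i)) /\
  order_ge n.+1 (tot n m \o tot n m).

Definition minC_mor (n : nat) (m m' : nat -> End) X :=
  [/\ diffeo X, has_degree 0 X & eqmod n (X \o tot n m) (tot n m' \o X)].

Definition pointed X := exists ph : nat -> End,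
  (forall i, (2 <= i)%N -> endo (ph i) /\ has_order i (ph i)) /\
  forall f : lhat, cvg_lhat (fun N => f + \sum_(2 <= i < N) ph i f) (X f).

Definition homotopic (n : nat) (m : nat -> End) X Y := exists eta,
  vfield (-1) eta /\
  eqmod n.-1 X (Y \o vexp (gcomm 1 (-1) (tot n m) eta)).

Definition pmor (n : nat) (m m' : nat -> End) :=
  {phi : End | pointed phi /\ minC_mor n m m' phi}.

Definition is_extension (n : nat) (m m' : nat -> End) (phi gamma : End) :=
  [/\ vfield 0 gamma, has_order n.-1 gamma &
      minC_mor n.+1 m m' (vexp gamma \o phi)].

Definition extendable (n : nat) (m m' : nat -> End) (phi : End) :=
  exists gamma, is_extension n m m' phi gamma.

Definition extension (n : nat) (m m' : nat -> End) (phi : End) :=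
  {gamma : End | is_extension n m m' phi gamma}.

Definition ext_equiv (n : nat) (m : nat -> End) (phi gamma gamma' : End) :=
  exists eta, [/\ vfield (-1) eta, has_order n.-2 eta &
    eqmod n (vexp gamma \o phi)
      (vexp gamma' \o phi \o vexp (gcomm 1 (-1) (tot n.+1 m) eta))].

Lemma lvalB (f g : lhat) w : lval (f - g) w = (lval f w : K) - lval g w.
Proof. by []. Qed.

Lemma continuousB X Y : lhat_continuous X -> lhat_continuous Y ->
  lhat_continuous (X - Y).
Proof.
move=> cX cY f w; have [S SX] := cX f w; have [S' SY] := cY f w.
exists (S ++ S') => g Sg.
change ((lval (X g) w : K) - lval (Y g) w = (lval (X f) w : K) - lval (Y f) w).
by rewrite SX ?SY // => u uS; apply: Sg; rewrite mem_cat uS ?orbT.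
Qed.

Lemma lbrBl (f f' g : lhat) : lbr (f - f') g = lbr f g - lbr f' g.
Proof.
apply/val_inj/funext => w.
change (br (f - f') g w = (br f g w : K) - br f' g w).
rewrite /br -sumrB; apply: eq_bigr => k _; rewrite !lvalB mulrBl !mulrBr.
by rewrite !opprB addrACA [RHS]addrACA; congr (_ + _); rewrite addrC.
Qed.

Lemma lbrBr (f g g' : lhat) : lbr f (g - g') = lbr f g - lbr f g'.
Proof.
apply/val_inj/funext => w.
change (br f (g - g') w = (br f g w : K) - br f g' w).
rewrite /br -sumrB; apply: eq_bigr => k _; rewrite !lvalB mulrBl !mulrBr.
by rewrite !opprB addrACA [RHS]addrACA; congr (_ + _); rewrite addrC.
Qed.

Lemma vfieldB d X Y : vfield d X -> vfield d Y -> vfield d (X - Y).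
Proof.
move=> [[lX cX] dX DX] [[lY cY] dY DY]; split.
- split; last exact: continuousB.
  move=> a f g; rewrite [LHS]/GRing.add /=.
  change (X (a *: f + g) - Y (a *: f + g) =
    a *: (X f - Y f) + (X g - Y g)).
  by rewrite lX lY scalerBr opprD addrACA.
- by move=> p f hf w; apply: grB; [apply: dX|apply: dY].
- move=> p f g hf.
  change (X (lbr f g) - Y (lbr f g) =
    lbr (X f - Y f) g + koszul (d * p) *: lbr f (X g - Y g)).
  by rewrite (DX _ _ _ hf) (DY _ _ _ hf) lbrBl lbrBr scalerBr opprD addrACA.
Qed.

Lemma vfield0 d : vfield d 0.
Proof.
split.
- split; last by move=> f w; exists [::].
  by move=> a f g; change (0 = a *: 0 + 0 :> lhat); rewrite scaler0 addr0.
- by move=> p f hf w; apply: gr0.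
- move=> p f g hf; change (0 = lbr 0 g + koszul (d * p) *: lbr f 0).
  have -> : lbr 0 g = 0 by have := lbrBl f f g; rewrite !subrr.
  have -> : lbr f 0 = 0 by have := lbrBr f g g; rewrite !subrr.
  by rewrite scaler0 addr0.
Qed.

Lemma has_orderB n X Y : has_order n X -> has_order n Y -> has_order n (X - Y).
Proof.
move=> oX oY i f fi w wi; change ((lval (X f) w : K) - lval (Y f) w = 0).
by rewrite (oX _ _ fi) // (oY _ _ fi) // subrr.
Qed.

Lemma linear_sub X (f g : lhat) : linear X -> X (f - g) = X f - X g.
Proof.
by move=> lX; have := lX (-1) g f; rewrite !scaleN1r ![- _ + _]addrC.
Qed.

Section Harrison.
Variable A : scAlgebra.

Lemma gcommB d e X Y : gcomm d e A (X - Y) = gcomm d e A X - gcomm d e A Y.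
Proof.
have [[lA _] _ _] := mul2_vfield A.
apply/funext => f.
change (A (X f - Y f) - koszul (d * e) *: (X (A f) - Y (A f)) =
 (A (X f) - koszul (d * e) *: X (A f)) - (A (Y f) - koszul (d * e) *: Y (A f))).
by rewrite linear_sub // scalerBr !opprB addrACA [RHS]addrACA; congr (_ + _); rewrite addrC.
Qed.

(* Bidegree (i, j) Harrison cochains: vector fields of order i and of degree j
   in Sigma^-1 Der, i.e. of degree j - 1 as vector fields. *)
Definition cochain (i : nat) (j : int) X := vfield (j - 1) X /\ has_order i X.

Definition harr_diff (j : int) X : End := gcomm 1 (j - 1) A X.

Definition cocycle_pred (i : nat) (j : int) : {pred End} :=
  fun X => `[< cochain i j X /\ harr_diff j X = 0 >].

Lemma cocycle_zmod i j : zmod_closed (cocycle_pred i j).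
Proof.
split.
  apply/asboolP; split; first by split; [apply: vfield0|move=> *].
  by rewrite -[X in harr_diff _ X](subrr 0) /harr_diff gcommB subrr.
move=> X Y /asboolP[[vX oX] dX] /asboolP[[vY oY] dY]; apply/asboolP; split.
  by split; [apply: vfieldB|apply: has_orderB].
by move: dX dY; rewrite /harr_diff gcommB => -> ->; rewrite subrr.
Qed.
HB.instance Definition _ i j :=
  GRing.isZmodClosed.Build End (cocycle_pred i j) (cocycle_zmod i j).

Record cocycle (i : nat) (j : int) :=
  Cocycle { cval :> End; _ : cval \in cocycle_pred i j }.
HB.instance Definition _ i j := [isSub for @cval i j].
HB.instance Definition _ i j := [Choice of cocycle i j by <:].
HB.instance Definition _ i j := [SubChoice_isSubZmodule of cocycle i j by <:].

Definition coboundary_pred (i : nat) (j : int) : {pred cocycle i j} :=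
  fun xi => `[< exists eta, cochain i.-1 (j - 1) eta /\
                            cval xi = harr_diff (j - 1) eta >].

Lemma coboundary_zmod i j : zmod_closed (@coboundary_pred i j).
Proof.
split.
  apply/asboolP; exists 0; split; first by split; [apply: vfield0|move=> *].
  by rewrite -[X in harr_diff _ X](subrr 0) /harr_diff gcommB subrr.
move=> x y /asboolP[e [[ve oe] xE]] /asboolP[e' [[ve' oe'] yE]].
apply/asboolP; exists (e - e'); split.
  by split; [apply: vfieldB|apply: has_orderB].
by rewrite /harr_diff gcommB [LHS](raddfB val) /= xE yE.
Qed.
HB.instance Definition _ i j :=
  GRing.isZmodClosed.Build (cocycle i j) (@coboundary_pred i j)
    (coboundary_zmod i j).

Definition HHarr (i : nat) (j : int) : zmodType :=
  Quotient.quot (@coboundary_pred i j).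

Definition hclass i j (xi : cocycle i j) : HHarr i j :=
  (\pi_(Quotient.quot (@coboundary_pred i j)) xi)%qT.

End Harrison.

End LieSeries.

(* The set of classes of a relation R, with the class of x as a member. *)
Definition classes (T : Type) (R : T -> T -> Prop) : Type :=
  {C : set T | exists x, C = [set y : T | R y x]%classic}.

Definition class_of (T : Type) (R : T -> T -> Prop) (x : T) : classes R :=
  exist _ [set y : T | R y x]%classic (ex_intro _ x erefl).

Section Moduli.
Context {K : comUnitRingType} (G : evenGrading K) {I : choiceType}.
Variable dg : I -> int.
Local Notation End := (lhat G dg -> lhat G dg).

Definition Mn (n : nat) (m m' : nat -> End) : Type :=
  classes (fun phi phi' : pmor n m m' => homotopic n m (sval phi) (sval phi')).

Definition EMn (n : nat) (m m' : nat -> End) (phi : End) : Type :=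
  classes (fun gamma gamma' : extension n m m' phi =>
    ext_equiv n m phi (sval gamma) (sval gamma')).

Definition eclass (n : nat) (m m' : nat -> End) (phi : End)
  (gamma : extension n m m' phi) : EMn n m m' phi := class_of _ gamma.

End Moduli.

Definition is_action (H : zmodType) (T : Type) (act : H -> T -> T) :=
  (forall x, act 0 x = x) /\ forall a b x, act (a + b) x = act a (act b x).

Definition free_action (H : zmodType) (T : Type) (act : H -> T -> T) :=
  forall a x, act a x = x -> a = 0.

Definition transitive_action (H : zmodType) (T : Type) (act : H -> T -> T) :=
  inhabited T /\ forall x y, exists a, act a x = y.

(* Main.v *)
(* Since n >= 3, the square of a field gamma of order n - 1 has order at least
   n, so exp gamma = id + gamma modulo (n). As phi = id modulo (2), the condition
   that exp gamma o phi be a C_(n+1)-morphism therefore linearizes to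
   [m_2, gamma] = phi o m - m' o phi modulo (n + 1), and equivalence of two
   extensions linearizes to gamma - gamma' = [m_2, eta] modulo (n). Both brackets
   are of pure order, and a continuous endomorphism of pure order n that lies in
   (n + 1) vanishes: the extensions form a torsor under the cocycles, and two of
   them are equivalent iff they differ by a coboundary. *)

Require Import Defs.
From HB Require Import structures.
From mathcomp Require Import all_boot all_order all_algebra.
From mathcomp Require Import all_classical.
From mathcomp Require Import zify ring.

Set Implicit Arguments.
Unset Strict Implicit.
Unset Printing Implicit Defensive.

Import GRing.Theory.
Local Open Scope ring_scope.

(** The overview takes exp for granted. But [vexp] is a limit with a junk default, and [lhat] holds
    only finite sums of homogeneous convergent Lie series, so the limit has to be constructed inside
    [lhat], with 1/k! shown to preserve degrees. Moreover a [minC_mor] must be a diffeomorphism, so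
    exp gamma has to respect brackets and be inverted by exp (- gamma). All of this is checked one
    word at a time, where every series becomes a finite sum. Each linearization is an exact identity
    whose correction terms are compositions; how far a composition raises word length is the sum
    over its factors, so estimating a correction is arithmetic. The criterion for an extension is
    affine in gamma, and its constant term is the same for all extensions of phi: the cocycle
    condition appears on subtracting two of them. Since [m_2, -] raises the order by one, eta of
    order n - 2 gives coboundaries of order n - 1. *)

Section LieSeriesFacts.
Context {K : comUnitRingType} (G : evenGrading K) {I : choiceType}.
Variable dg : I -> int.
Local Notation L := (lhat G dg).
Local Notation End := (L -> L).

(** * Rational scalars and the grading of [K] *)

Lemma natr_unit k : (k.+1%:R : K) \is a GRing.unit.
Proof.
have [q _] := gr_rat G.
by rewrite -(rmorph_nat q); apply: rmorph_unit; rewrite unitfE Num.Theory.pnatr_eq0.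
Qed.

Lemma fact_unit k : ((k`!)%:R : K) \is a GRing.unit.
Proof. by have := natr_unit (k`!).-1; rewrite prednK ?fact_gt0. Qed.

Lemma gr_mulrn i x k : G i x -> G i (x *+ k).
Proof.
by move=> Gx; elim: k => [|k IH]; rewrite ?mulr0n ?mulrS; [exact: gr0|exact: grD].
Qed.

(* Division by k preserves the grading since the inverse of k has degree 0: only
   the degree i part of x / k can survive multiplication by k. *)
Lemma gr_divn i x k : G i x -> G i (k.+1%:R^-1 * x).
Proof.
move=> Gx; set y := _ * x; have [s [c [Gc yE]]] := gr_span G y.
pose d j := c j *+ count_mem j s.
have Gd j : G j (d j) by apply: gr_mulrn.
have yd : y = \sum_(j <- undup (i :: s)) d j.
  rewrite yE -big_undup_iterop_count /=.
  have -> : \sum_(j <- undup s) iterop (count_mem j s) +%R (c j) 0 =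
            \sum_(j <- undup s) d j by [].
  rewrite /=; case: ifP => // si.
  have d0 : d i = 0 by rewrite /d (count_memPn _) ?si ?mulr0n.
  by rewrite big_cons d0 add0r.
pose e j := k.+1%:R * d j - (if j == i then x else 0).
suff e0 : e i = 0.
  suff -> : y = d i by [].
  move/eqP: e0; rewrite /e eqxx subr_eq0 => /eqP e0.
  by rewrite /y -e0 mulKr ?natr_unit.
apply: (gr_free (s := undup (i :: s)) (c := e)); first exact: undup_uniq.
- move=> j; apply: grB; first by rewrite mulr_natl; apply: gr_mulrn.
  by case: eqP => [->|_] //; apply: gr0.
- rewrite sumrB -mulr_sumr -yd mulrA mulrV ?natr_unit // mul1r.
  rewrite (bigD1_seq i) ?undup_uniq ?mem_undup ?inE ?eqxx //=.
  by rewrite big1 => [|j /negPf->]; rewrite ?addr0 ?subrr.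
- by rewrite mem_undup inE eqxx.
Qed.

(** * Lie series sorted by word length *)

Fixpoint leaves (t : lieTree I) : nat :=
  if t is LieBr a b then leaves a + leaves b else 1.

Lemma leaves_gt0 t : (0 < leaves t)%N.
Proof. by elim: t => //= a aP b bP; rewrite addn_gt0 aP. Qed.

(** A bracket only concatenates words, in either order, so lengths add up to the number of leaves.
    Hence a Lie series can be cut or assembled length by length through its coefficients on
    trees. *)
Lemma lieMon_leaves t w : size w != leaves t -> lieMon dg t w = 0 :> K.
Proof.
elim: t w => [i|a IHa b IHb] w /=; first by case: (w =P [:: i]) => [->|].
move=> ne; apply: big1 => k _.
have szE : (size (take k w) + size (drop k w) = size w)%N.
  by rewrite -size_cat cat_take_drop.
have [ta|/IHa->] := eqVneq (size (take k w)) (leaves a); last first.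
  have [da|/IHa->] := eqVneq (size (drop k w)) (leaves a); last first.
    by rewrite mul0r !mulr0 subrr.
  by rewrite mul0r IHb ?mul0r ?mulr0 ?subrr //; apply: contra ne => /eqP; lia.
rewrite (IHb (drop k w)); last by apply: contra ne => /eqP; lia.
have [da|/IHa->] := eqVneq (size (drop k w)) (leaves a); last by rewrite !mulr0 subrr.
by rewrite IHb ?mul0r ?mulr0 ?subrr //; apply: contra ne => /eqP; lia.
Qed.

Implicit Types (f g : L) (X Y Z : End).

Lemma lvalD f g w : lval (f + g) w = (lval f w : K) + lval g w.
Proof. by []. Qed.

Lemma lvalZ (k : K) f w : lval (k *: f) w = k * (lval f w : K).
Proof. by []. Qed.

Lemma lval_sum (J : Type) (s : seq J) (P : pred J) (F : J -> L) w :
  lval (\sum_(j <- s | P j) F j) w = \sum_(j <- s | P j) (lval (F j) w : K).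
Proof. by elim/big_rec2: _ => // j y z _ <-. Qed.

Lemma lhat_ext f g : (forall w, lval f w = lval g w) -> f = g.
Proof. by move=> fg; apply/val_inj/funext. Qed.

Lemma is_lieD (f g : nseries (K := K)) : is_lie dg f -> is_lie dg g -> is_lie dg (f + g).
Proof.
move=> [c cf] [d dg']; exists (fun t => c t + d t) => w.
have [s Hs] := lie_sum_unif [:: w] cf; have [s' Hs'] := lie_sum_unif [:: w] dg'.
have uS : uniq (undup (s ++ s')) by apply: undup_uniq.
exists (undup (s ++ s')).
have [|t0 tE] := Hs _ uS _ w (mem_head _ _).
  by move=> t ts; rewrite mem_undup mem_cat ts.
have [|t0' tE'] := Hs' _ uS _ w (mem_head _ _).
  by move=> t ts; rewrite mem_undup mem_cat ts orbT.
split=> // [t tS|]; first by rewrite mulrDl t0 // t0' // addr0.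
transitivity ((f w : K) + g w) => //.
by rewrite tE tE' -big_split; apply: eq_bigr => t _; rewrite mulrDl.
Qed.

Lemma is_lie0 : is_lie dg (0 : nseries (K := K)).
Proof.
by exists (fun=> 0) => w; exists [::]; split=> // [t _|]; rewrite ?mul0r ?big_nil.
Qed.

Lemma is_lie_lval f : is_lie dg f.
Proof.
have /asboolP[s [hs ->]] := valP f.
elim: s hs => [|g s IH] hs; first by rewrite big_nil; apply: is_lie0.
rewrite big_cons; apply: is_lieD; first by have [] := hs g (mem_head _ _).
by apply: IH => h h_s; apply: hs; rewrite inE h_s orbT.
Qed.

Lemma lhat_homogP (f : nseries (K := K)) p :
  is_lie dg f -> homog G dg p f -> f \in lhat_pred G dg.
Proof.
move=> lf hf; apply/asboolP; exists [:: f]; split; last by rewrite big_seq1.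
by move=> g; rewrite inE => /eqP->; split=> //; exists p.
Qed.

(** Membership in [lhat] is easy to establish for a homogeneous Lie series; this induction peels off
    such summands one at a time. *)
Lemma lhat_homog_ind (P : L -> Prop) : P 0 ->
  (forall p f g, homog G dg p f -> P g -> P (f + g)) -> forall f, P f.
Proof.
move=> P0 PD f; have /asboolP[s [hs fE]] := valP f.
elim: s f hs fE => [|h s IH] f hs fE.
  by have -> : f = 0 by apply: val_inj; rewrite fE big_nil.
have [lh [p hp]] := hs h (mem_head _ _).
pose h' := Lhat (lhat_homogP lh hp).
have -> : f = h' + (f - h') by rewrite addrC subrK.
apply: (PD p h' _ hp); apply: IH => [g g_s|]; first by apply: hs; rewrite inE g_s orbT.
by rewrite [LHS](raddfB val) /= fE big_cons addrAC subrr add0r.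
Qed.

Lemma lval_nil f : lval f [::] = 0.
Proof.
have [c /(_ [::])[s [_ _ ->]]] := is_lie_lval f.
apply: big1 => t _; rewrite lieMon_leaves ?mulr0 //.
by rewrite eq_sym -lt0n leaves_gt0.
Qed.

Definition trunc k (f : nseries (K := K)) : nseries (K := K) :=
  fun w : seq I => if size w == k then f w else 0.

Lemma is_lie_trunc k (f : nseries (K := K)) : is_lie dg f -> is_lie dg (trunc k f).
Proof.
move=> [c cf]; exists (fun t => if leaves t == k then c t else 0) => w.
have [s [us z E]] := cf w; exists s; split=> // [t /z|].
  by case: ifP => // _ _; rewrite mul0r.
rewrite /trunc; case: ifP => wk.
  rewrite E; apply: eq_bigr => t _; case: ifP => // tk.
  by rewrite lieMon_leaves ?mulr0 // (eqP wk) eq_sym tk.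
apply/esym/big1 => t _; case: eqP => [tk|]; rewrite ?mul0r //.
by rewrite lieMon_leaves ?mulr0 // tk wk.
Qed.

Lemma truncP k f : trunc k f \in lhat_pred G dg.
Proof.
elim/lhat_homog_ind: f => [|p f g hf].
  have -> : trunc k (lval (0 : L)) = 0 by apply/funext => w; rewrite /trunc if_same.
  exact: rpred0.
have -> : trunc k (lval (f + g)) = trunc k f + trunc k g.
  apply/funext => w; transitivity ((trunc k f w : K) + trunc k g w) => //.
  by rewrite /trunc; case: ifP => // _; rewrite addr0.
move=> tg; apply: rpredD => //; apply: (@lhat_homogP _ p).
  exact/is_lie_trunc/is_lie_lval.
by move=> w; rewrite /trunc; case: ifP => // _; apply: gr0.
Qed.

Definition component k f : L := Lhat (truncP k f).

Lemma component_order k f : elt_order k (component k f).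
Proof. by move=> w /negPf wk; rewrite /= /trunc wk. Qed.

(** * The filtration by word length *)

Definition zero_below M f := forall w, (size w < M)%N -> lval f w = 0.

(* For a continuous endomorphism this is membership in (j.+1), see order_geP; the
   shift of the index makes it additive under composition. *)
Definition raises j X := forall M f, zero_below M f -> zero_below (M + j) (X f).

Lemma endo0 X : endo X -> X 0 = 0.
Proof. by move=> [lX _]; have := linear_sub 0 0 lX; rewrite !subrr. Qed.

(** By continuity the coefficient at w depends on f at finitely many words, and on these f agrees
    with a finite sum of its components. *)
Lemma endo_component_eq0 X f w : endo X ->
  (forall k, lval (X (component k f)) w = 0) -> lval (X f) w = 0.
Proof.
move=> eX X0; have [S HS] := eX.2 f w.
(* The successor makes the sum over k < N include the longest words of [S]. *)
pose N := (\max_(u <- S) size u).+1.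
rewrite -(HS (\sum_(k < N) component k f)) => [|u uS].
  elim/big_rec: _ => [|k g _ IH]; first by rewrite (endo0 eX).
  by have := eX.1 1 (component k f) g; rewrite !scale1r => ->; rewrite lvalD X0 add0r.
have uN : (size u < N)%N by rewrite ltnS; apply: leq_bigmax_seq.
rewrite lval_sum (bigD1 (Ordinal uN)) //= big1 ?addr0 => [|k kN].
  by rewrite /trunc eqxx.
by rewrite /trunc; case: eqP => // uk; case/eqP: kN; apply/val_inj.
Qed.

Lemma zero_below_leq M N f : (N <= M)%N -> zero_below M f -> zero_below N f.
Proof. by move=> NM f0 w wN; apply: f0; apply: leq_trans NM. Qed.

Lemma elt_order_below M f : elt_order M f -> zero_below M f.
Proof. by move=> fM w wM; apply: fM; rewrite neq_ltn wM. Qed.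

(** [order_ge] tests X on elements of a single order only; a general f is reached through its
    components, of which those below M vanish. *)
Lemma order_geP j X : order_ge j.+1 X <-> endo X /\ raises j X.
Proof.
split=> [[eX oX]|[eX rX]]; split=> //.
  move=> M f f0 w wM; apply: endo_component_eq0 => // k.
  have [kM|Mk] := ltnP k M.
    have -> : component k f = 0.
      apply: lhat_ext => u; rewrite /= /trunc; case: eqP => // uk.
      by rewrite f0 // uk.
    by rewrite (endo0 eX).
  by apply: (oX k) => //; [exact: component_order | lia].
move=> i f fi w wi; apply: (rX i); first exact: elt_order_below.
lia.
Qed.

Lemma has_order_raises j X : endo X -> has_order j.+1 X -> raises j X.
Proof.
move=> eX oX; have /order_geP[] // : order_ge j.+1 X.
by split=> // i f fi w wi; apply: (oX _ _ fi); rewrite neq_ltn wi.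
Qed.

(** On the component of length k, order j leaves only words of length k + j - 1, and raising by j
    kills everything shorter than k + j. This turns congruences into equalities. *)
Lemma has_order_eq0 j X : endo X -> has_order j X -> raises j X -> X = 0.
Proof.
move=> eX oX rX; apply/funext => f; apply: lhat_ext => w.
apply: endo_component_eq0 => // k.
have [wk|wk] := eqVneq (size w + 1)%N (k + j)%N; last first.
  exact: oX _ _ (@component_order k f) _ wk.
by apply: (rX k); [apply/elt_order_below/component_order | lia].
Qed.

(** * Closure properties of continuous endomorphisms *)

Lemma endo_sum X (J : Type) (s : seq J) (P : pred J) (F : J -> L) : endo X ->
  X (\sum_(j <- s | P j) F j) = \sum_(j <- s | P j) X (F j).
Proof.
move=> eX; apply: (big_morph X) => [f g|]; last exact: endo0.
by have := eX.1 1 f g; rewrite !scale1r.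
Qed.

Lemma endoZ X k f : endo X -> X (k *: f) = k *: X f.
Proof. by move=> eX; have := eX.1 k f 0; rewrite (endo0 eX) !addr0. Qed.

Lemma endoD X f g : endo X -> X (f + g) = X f + X g.
Proof. by move=> eX; have := eX.1 1 f g; rewrite !scale1r. Qed.

Lemma endoB X f g : endo X -> X (f - g) = X f - X g.
Proof. by move=> [lX _]; apply: linear_sub. Qed.

Lemma endo_id : endo (id : End).
Proof. by split=> // f w; exists [:: w] => g; apply; apply: mem_head. Qed.

Lemma endo_sub X Y : endo X -> endo Y -> endo (X - Y).
Proof.
move=> [lX cX] [lY cY]; split; last exact: continuousB.
move=> a f g; change (X (a *: f + g) - Y (a *: f + g) = a *: (X f - Y f) + (X g - Y g)).
by rewrite lX lY scalerBr opprD addrACA.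
Qed.

Lemma endo_zero : endo (0 : End).
Proof.
split=> [a f g|f w]; last by exists [::].
by change (0 = a *: 0 + 0 :> L); rewrite scaler0 addr0.
Qed.

Lemma endo_opp X : endo X -> endo (- X).
Proof. by rewrite -sub0r; apply/endo_sub/endo_zero. Qed.

Lemma endo_add X Y : endo X -> endo Y -> endo (X + Y).
Proof. by move=> eX eY; rewrite -[Y]opprK; apply/endo_sub/endo_opp. Qed.

Lemma endo_scale k X : endo X -> endo (k *: X).
Proof.
move=> eX; split=> [a f g|f w].
  change (k *: X (a *: f + g) = a *: (k *: X f) + k *: X g).
  by rewrite eX.1 scalerDr !scalerA mulrC.
have [S HS] := eX.2 f w; exists S => g /HS E.
by change (lval (k *: X g) w = lval (k *: X f) w); rewrite !lvalZ E.
Qed.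

Lemma continuous_seq Y f (S : seq (seq I)) : lhat_continuous Y ->
  exists T : seq (seq I), forall g, (forall v, v \in T -> lval g v = lval f v) ->
  forall v, v \in S -> lval (Y g) v = lval (Y f) v.
Proof.
move=> cY; elim: S => [|u S [T' HT']]; first by exists [::].
have [T HT] := cY f u; exists (T ++ T') => g gT v; rewrite inE => /orP[/eqP->|vS].
  by apply: HT => x xT; apply: gT; rewrite mem_cat xT.
by apply: HT' vS => x xT; apply: gT; rewrite mem_cat xT orbT.
Qed.

Lemma endo_comp X Y : endo X -> endo Y -> endo (X \o Y).
Proof.
move=> [lX cX] [lY cY]; split=> [a f g|f w]; first by rewrite /= lY lX.
have [S HS] := cX (Y f) w; have [T HT] := continuous_seq f S cY.
by exists T => g gT; apply: HS => v vS; apply: HT.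
Qed.

Lemma endo_iter X k : endo X -> endo (iter k X).
Proof.
move=> eX; elim: k => [|k IH]; first exact: endo_id.
exact: (endo_comp eX IH).
Qed.

Lemma zero_belowD M f g : zero_below M f -> zero_below M g -> zero_below M (f + g).
Proof. by move=> f0 g0 w wM; rewrite lvalD f0 // g0 // addr0. Qed.

Lemma zero_belowZ M k f : zero_below M f -> zero_below M (k *: f).
Proof. by move=> f0 w wM; rewrite lvalZ f0 // mulr0. Qed.

Lemma zero_belowN M f : zero_below M f -> zero_below M (- f).
Proof. by move=> f0; rewrite -scaleN1r; apply: zero_belowZ. Qed.

Lemma zero_belowB M f g : zero_below M f -> zero_below M g -> zero_below M (f - g).
Proof. by move=> f0 g0; apply/zero_belowD/zero_belowN. Qed.

Lemma zero_below1 f : zero_below 1 f.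
Proof. by case=> // _; apply: lval_nil. Qed.

Lemma raisesD j X Y : raises j X -> raises j Y -> raises j (X + Y).
Proof. by move=> rX rY M f f0; apply: zero_belowD; [apply: rX|apply: rY]. Qed.

Lemma raisesB j X Y : raises j X -> raises j Y -> raises j (X - Y).
Proof. by move=> rX rY M f f0; apply: zero_belowB; [apply: rX|apply: rY]. Qed.

Lemma raisesN j X : raises j X -> raises j (- X).
Proof. by move=> rX M f f0; apply/zero_belowN/rX. Qed.

Lemma raises_leq i j X : (i <= j)%N -> raises j X -> raises i X.
Proof. by move=> ij rX M f /rX; apply: zero_below_leq; lia. Qed.

Lemma raises_comp i j X Y : raises i X -> raises j Y -> raises (i + j) (X \o Y).
Proof. by move=> rX rY M f /rY/rX; rewrite addnAC addnA. Qed.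

Lemma raises_iter j k X : raises j X -> raises (k * j) (iter k X).
Proof.
move=> rX; elim: k => [|k IH]; first by move=> M f; rewrite addn0.
by rewrite mulSn; apply: (raises_comp rX IH).
Qed.

(** A tree contributes only at words as long as its number of leaves, so cutting the sum over k at
    [leaves t] has the same effect as cutting it at [size w], and gives each tree one finite
    coefficient. *)
Lemma is_lie_series (u : nat -> nseries (K := K)) : (forall k, is_lie dg (u k)) ->
  is_lie dg (fun w : seq I => \sum_(k < size w) u k w).
Proof.
move=> /choice[c cP]; exists (fun t => \sum_(k < leaves t) c k t) => w.
have /choice[s sP] := fun k => lie_sum_unif [:: w] (cP k).
pose S := undup (flatten [seq s k | k <- iota 0 (size w)]).
have uS : uniq S by apply: undup_uniq.
have {}sP (k : 'I_(size w)) : (forall t, t \notin S -> c k t * lieMon dg t w = 0) /\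
    u k w = \sum_(t <- S) c k t * lieMon dg t w.
  apply: (sP k S uS _ w (mem_head _ _)) => t ts.
  rewrite mem_undup; apply/flattenP; exists (s k) => //.
  by apply: map_f; rewrite mem_iota ltn_ord.
have cE t : (\sum_(k < leaves t) c k t) * lieMon dg t w =
    \sum_(k < size w) c k t * lieMon dg t w.
  have [<-|tw] := eqVneq (size w) (leaves t); first by rewrite mulr_suml.
  by rewrite lieMon_leaves // mulr0 big1 // => k _; rewrite mulr0.
exists S; split=> // [t tS|].
  by rewrite cE big1 // => k _; apply: (sP k).1.
under [RHS]eq_bigr do rewrite cE.
by rewrite exchange_big; apply: eq_bigr => k _; apply: (sP k).2.
Qed.

(** * The exponential of a vector field *)

Definition exp_term X k f : L := ((k`!)%:R^-1 : K) *: iter k X f.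

(* Degree 0 is what keeps exp X f inside lhat, which is only the direct sum, not
   the product, of its homogeneous parts. *)
Definition expable X := [/\ endo X, has_degree 0 X & raises 1 X].

Lemma exp_termS X k f : endo X -> (k.+1%:R : K) *: exp_term X k.+1 f = X (exp_term X k f).
Proof.
move=> eX; rewrite /exp_term (endoZ _ _ eX) scalerA /=; congr (_ *: _).
by rewrite factS natrM invrM ?natr_unit ?fact_unit // mulrCA mulrV ?natr_unit // mulr1.
Qed.

Lemma exp_term_endo X k : endo X -> endo (exp_term X k).
Proof. by move=> eX; apply/endo_scale/endo_iter. Qed.

Lemma exp_term_raises X j k : raises j X -> raises (k * j) (exp_term X k).
Proof. by move=> rX M f /(raises_iter (k := k) rX); apply: zero_belowZ. Qed.

(** A Lie series has no constant term, so f starts in length 1 and the k-th term in length k + 1;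
    hence the bound is not strict. *)
Lemma exp_term_eq0 X k f w : raises 1 X -> (size w <= k)%N -> lval (exp_term X k f) w = 0.
Proof.
by move=> rX wk; apply: (exp_term_raises (k := k) rX (@zero_below1 f)); rewrite muln1.
Qed.

Lemma has_degree0_iter X k : has_degree 0 X -> has_degree 0 (iter k X).
Proof.
move=> dX p f fp; rewrite addr0; elim: k => // k IH.
by rewrite -[p]addr0; apply: dX.
Qed.

Lemma gr_divfact i x k : G i x -> G i ((k`!)%:R^-1 * x).
Proof. by move=> Gx; have := @gr_divn i x (k`!).-1 Gx; rewrite prednK ?fact_gt0. Qed.

Lemma exp_term_degree X k : has_degree 0 X -> has_degree 0 (exp_term X k).
Proof.
by move=> dX p f fp w; rewrite /exp_term lvalZ; apply/gr_divfact/has_degree0_iter.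
Qed.

Lemma exp_sum_stable X f w N : raises 1 X -> (size w <= N)%N ->
  \sum_(k < N) (lval (exp_term X k f) w : K) =
  \sum_(k < size w) (lval (exp_term X k f) w : K).
Proof.
move=> rX wN; rewrite [RHS](big_ord_widen N (fun k => lval (exp_term X k f) w : K) wN).
rewrite [RHS]big_mkcond; apply: eq_bigr => k _; case: ifP => // /negbT; rewrite -leqNgt.
exact: exp_term_eq0.
Qed.

(** On a homogeneous summand the coefficientwise sum is a homogeneous Lie series, hence lies in
    [lhat]. The bound [size w <= N] does not depend on f, so the limits of the summands can be
    added. *)
Lemma exp_ex X f : expable X -> exists g : L, forall w N, (size w <= N)%N ->
  lval g w = \sum_(k < N) (lval (exp_term X k f) w : K).
Proof.
move=> [eX dX rX]; elim/lhat_homog_ind: f => [|p f f' fp [g' g'E]].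
  exists 0 => w N _; rewrite big1 // => k _.
  by rewrite (endo0 (exp_term_endo k eX)).
pose h : nseries := fun w : seq I => \sum_(k < size w) (lval (exp_term X k f) w : K).
have hL : h \in lhat_pred G dg.
  apply: (@lhat_homogP _ p).
    by apply: (@is_lie_series (fun k => lval (exp_term X k f))) => k; apply: is_lie_lval.
  move=> w; apply: gr_sum => k.
  by have := exp_term_degree k dX fp w; rewrite addr0.
exists (Lhat hL + g') => w N wN; rewrite lvalD (g'E _ _ wN).
have -> : lval (Lhat hL) w = \sum_(k < N) (lval (exp_term X k f) w : K).
  by rewrite exp_sum_stable.
rewrite -big_split; apply: eq_bigr => k _.
by rewrite (endoD _ _ (exp_term_endo k eX)).
Qed.

Lemma vexpE X f w N : expable X -> (size w <= N)%N ->
  lval (vexp X f) w = \sum_(k < N) (lval (exp_term X k f) w : K).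
Proof.
move=> xX wN; have [_ _ rX] := xX; have [g gE] := exp_ex f xX.
pose C := [set g : L | cvg_lhat (fun N => \sum_(k < N) exp_term X k f) g]%classic.
have : C (xget 0 C).
  apply: (@xgetPex _ 0 C); exists g => u; exists (size u) => M uM.
  by rewrite lval_sum (gE _ _ uM).
(* The default of [xget] is excluded. The limit is read off at a stage past both M and N, and from
   [size w] on the partial sums are constant. *)
move=> /(_ w)[M /(_ (maxn M N) (leq_maxl _ _))] <-; rewrite lval_sum.
by rewrite !exp_sum_stable // leq_max wN orbT.
Qed.

Lemma vexp_endo X : expable X -> endo (vexp X).
Proof.
move=> xX; have [eX _ _] := xX.
(* At a fixed word the exponential is a partial sum of fixed length, from which linearity and
   continuity are inherited. *)
have sumE f w : lval (vexp X f) w = lval ((\sum_(k < size w) exp_term X k) f) w.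
  rewrite (vexpE f xX (leqnn _)); elim: (size w) => [|N IH]; first by rewrite !big_ord0.
  by rewrite !big_ord_recr /= IH.
have eS N : endo (\sum_(k < N) exp_term X k).
  elim/big_rec: _ => [|k Y _ eY]; first exact: endo_zero.
  by apply: endo_add => //; apply: exp_term_endo.
split=> [a f g|f w].
  by apply: lhat_ext => w; rewrite sumE (eS _).1 lvalD lvalZ -!sumE.
have [S HS] := (eS (size w)).2 f w.
by exists S => g /HS; rewrite -!sumE.
Qed.

Lemma vexp_degree X : expable X -> has_degree 0 (vexp X).
Proof.
move=> xX p f fp w; have [_ dX _] := xX; rewrite (vexpE f xX (leqnn _)).
by apply: gr_sum => k; apply: exp_term_degree.
Qed.

Lemma vexp_raises1 X j : expable X -> raises j X -> raises j (vexp X - id).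
Proof.
move=> xX rX M f f0 w wM; change (lval (vexp X f - f) w = 0).
(* One summand beyond [size w] is taken so that the term k = 0 splits off even at the empty word. *)
rewrite lvalB (vexpE f xX (leqnSn _)) big_ord_recl /exp_term /= invr1 scale1r.
rewrite addrC addKr big1 // => k _; apply: (exp_term_raises rX f0).
by rewrite /bump /=; nia.
Qed.

Lemma vexp_raises2 X j : expable X -> raises j X -> raises (2 * j) (vexp X - id - X).
Proof.
move=> xX rX M f f0 w wM; change (lval (vexp X f - f - X f) w = 0).
rewrite !lvalB (vexpE f xX (leq_trans (leqnSn _) (leqnSn _))) !big_ord_recl.
rewrite /exp_term /= !invr1 !scale1r big1 => [|k _].
  by rewrite addr0 [X in X - _]addrAC subrr add0r subrr.
apply: (exp_term_raises rX f0).
by rewrite /bump /=; nia.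
Qed.

(** * Exponentials of vector fields as automorphisms *)

Lemma triangle_sum (V : nmodType) (a : nat -> nat -> V) N :
  \sum_(k < N) \sum_(i < k.+1) a i (k - i)%N = \sum_(i < N) \sum_(j < N - i) a i j.
Proof.
elim: N => [|N IH]; first by rewrite !big_ord0.
rewrite big_ord_recr /= IH.
(* The new antidiagonal i + j = N appends one entry to each row; row N was empty before. *)
transitivity (\sum_(i < N.+1) (\sum_(j < N - i) a i j + a i (N - i)%N)).
  by rewrite big_split /= [X in _ = X + _]big_ord_recr /= subnn big_ord0 addr0.
by apply: eq_bigr => i _; rewrite subSn ?big_ord_recr // -ltnS.
Qed.

Lemma triangle_sum_trunc (V : nmodType) (a : nat -> nat -> V) N :
  (forall i j, (N <= i + j)%N -> a i j = 0) ->
  \sum_(i < N) \sum_(j < N) a i j = \sum_(k < N) \sum_(i < k.+1) a i (k - i)%N.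
Proof.
move=> a0; rewrite triangle_sum; apply: eq_bigr => i _.
rewrite [RHS](big_ord_widen N (a i)) ?leq_subr // [RHS]big_mkcond.
by apply: eq_bigr => j _; case: ltnP => // ij; apply: a0; lia.
Qed.

Lemma lbr0l g : lbr 0 g = 0 :> L.
Proof. by have := lbrBl 0 0 g; rewrite !subrr. Qed.

Lemma lbr0r f : lbr f 0 = 0 :> L.
Proof. by have := lbrBr f 0 0; rewrite !subrr. Qed.

Lemma lbrDl f f' g : lbr (f + f') g = lbr f g + lbr f' g :> L.
Proof.
have -> : f + f' = f - (0 - f') by rewrite sub0r opprK.
by rewrite !lbrBl lbr0l sub0r opprK.
Qed.

Lemma lbrDr f g g' : lbr f (g + g') = lbr f g + lbr f g' :> L.
Proof.
have -> : g + g' = g - (0 - g') by rewrite sub0r opprK.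
by rewrite !lbrBr lbr0r sub0r opprK.
Qed.

Lemma lbrZl k f g : lbr (k *: f) g = k *: lbr f g :> L.
Proof.
apply: lhat_ext => w; change (br dg (lval (k *: f)) g w = k * (br dg f g w : K)).
rewrite /br mulr_sumr; apply: eq_bigr => i _; rewrite !lvalZ mulrBr mulrA.
by congr (_ - _); rewrite !mulrA; congr (_ * _); rewrite mulrC mulrA.
Qed.

Lemma lbrZr k f g : lbr f (k *: g) = k *: lbr f g :> L.
Proof.
apply: lhat_ext => w; change (br dg f (lval (k *: g)) w = k * (br dg f g w : K)).
rewrite /br mulr_sumr; apply: eq_bigr => i _; rewrite !lvalZ mulrBr mulrCA.
by congr (_ - _); rewrite !mulrA [k * _]mulrC.
Qed.

Lemma zero_below_lbr M N f g :
  zero_below M f -> zero_below N g -> zero_below (M + N) (lbr f g).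
Proof.
move=> f0 g0 w wMN; apply: big1 => k _.
have szE : (size (take k w) + size (drop k w) = size w)%N.
  by rewrite -size_cat cat_take_drop.
have t1 : (lval f (take k w) : K) * lval g (drop k w) = 0.
  have [tM|Mt] := ltnP (size (take k w)) M; first by rewrite f0 ?mul0r.
  by rewrite (g0 (drop k w)) ?mulr0 //; lia.
have t2 : (lval g (take k w) : K) * lval f (drop k w) = 0.
  have [tN|Nt] := ltnP (size (take k w)) N; first by rewrite g0 ?mul0r.
  by rewrite (f0 (drop k w)) ?mulr0 //; lia.
by rewrite t1 t2 mulr0 subrr.
Qed.

(** The Leibniz rule in [vfield] is stated for homogeneous f because of its sign; in degree 0 the
    sign is 1 and additivity removes the restriction. *)
Lemma vfield0_lbr X f g : vfield 0 X -> X (lbr f g) = lbr (X f) g + lbr f (X g).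
Proof.
move=> [eX dX DX]; elim/lhat_homog_ind: f => [|p f f' fp IH].
  by rewrite !lbr0l (endo0 eX) lbr0l add0r.
rewrite lbrDl !(endoD _ _ eX) IH (DX _ _ _ fp) mul0r /koszul expr0 scale1r.
by rewrite !lbrDl addrACA.
Qed.

Lemma natr_scaleI k : injective (fun f => (k.+1%:R : K) *: f).
Proof.
move=> f g /(congr1 ( *:%R (k.+1%:R^-1 : K))).
by rewrite !scalerA mulVr ?natr_unit // !scale1r.
Qed.

(** The Leibniz rule for the divided powers X^k / k!, which absorb the binomial coefficients. The
    induction step is compared after multiplication by k + 1. *)
Lemma exp_term_lbr X k f g : vfield 0 X ->
  exp_term X k (lbr f g) =
  \sum_(i < k.+1) lbr (exp_term X i f) (exp_term X (k - i) g).
Proof.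
move=> vX; have [eX _ _] := vX; elim: k => [|k IH].
  by rewrite big_ord1 /exp_term /= invr1 !scale1r.
apply: (@natr_scaleI k).
rewrite exp_termS // IH (endo_sum _ _ _ eX).
have XT i j : X (lbr (exp_term X i f) (exp_term X j g)) =
    (i.+1%:R : K) *: lbr (exp_term X i.+1 f) (exp_term X j g) +
    (j.+1%:R : K) *: lbr (exp_term X i f) (exp_term X j.+1 g).
  by rewrite vfield0_lbr // -(exp_termS i) // -(exp_termS j) // lbrZl (lbrZr j.+1%:R).
under eq_bigr => i _ do rewrite XT.
rewrite big_split scaler_sumr.
(* The factor k + 1 splits as i + (k + 1 - i), one part for each argument of the bracket that the
   last X may hit. *)
transitivity (\sum_(i < k.+2)
    ((i : nat)%:R *: lbr (exp_term X i f) (exp_term X (k.+1 - i) g) +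
    (k.+1 - i)%:R *: lbr (exp_term X i f) (exp_term X (k.+1 - i) g))); last first.
  by apply: eq_bigr => i _; rewrite -scalerDl -natrD subnKC // -ltnS.
rewrite big_split; congr (_ + _).
  rewrite [RHS]big_ord_recl /= scale0r add0r.
  by apply: eq_bigr => i _; rewrite /bump /= add1n subSS.
rewrite [RHS]big_ord_recr /= subnn scale0r addr0.
by apply: eq_bigr => i _; rewrite subSn // -ltnS.
Qed.

Lemma zero_below_vexpB X f N : expable X ->
  zero_below N (vexp X f - \sum_(k < N) exp_term X k f).
Proof.
by move=> xX w wN; rewrite lvalB lval_sum (vexpE f xX (ltnW wN)) subrr.
Qed.

Lemma zero_belowE M f g w : zero_below M (f - g) -> (size w < M)%N ->
  lval f w = lval g w.
Proof. by move=> fg /fg/eqP; rewrite lvalB subr_eq0 => /eqP. Qed.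

Lemma vexp_lbr X f g : vfield 0 X -> raises 1 X ->
  vexp X (lbr f g) = lbr (vexp X f) (vexp X g).
Proof.
move=> vX rX; have [eX dX _] := vX; have xX : expable X by split.
apply: lhat_ext => w; pose N := (size w).+1.
pose S h := \sum_(k < N) exp_term X k h.
(* The tails of both exponentials start in length N, past w, and bracketing does not shorten words;
   what remains is a finite Cauchy product. *)
have -> : lval (lbr (vexp X f) (vexp X g)) w = lval (lbr (S f) (S g)) w.
  apply: (@zero_belowE N) => //.
  have -> : lbr (vexp X f) (vexp X g) - lbr (S f) (S g) =
      lbr (vexp X f - S f) (vexp X g) + lbr (S f) (vexp X g - S g).
    by rewrite lbrBl lbrBr addrA subrK.
  apply: zero_belowD.
    by rewrite -[N]addn0; apply: zero_below_lbr => //; apply: zero_below_vexpB.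
  by rewrite -[N]add0n; apply: zero_below_lbr => //; apply: zero_below_vexpB.
rewrite (vexpE _ xX (leqnSn _)).
pose a i j : K := lval (lbr (exp_term X i f) (exp_term X j g)) w.
transitivity (\sum_(i < N) \sum_(j < N) a i j).
  rewrite triangle_sum_trunc => [|i j ij].
    by apply: eq_bigr => k _; rewrite exp_term_lbr // lval_sum.
  apply: (zero_below_lbr (exp_term_raises (k := i) rX (@zero_below1 f))
                         (exp_term_raises (k := j) rX (@zero_below1 g))).
  by rewrite /N in ij; lia.
have lbr_suml J (s : seq J) (P : pred J) (F : J -> L) h :
    lbr (\sum_(j <- s | P j) F j) h = \sum_(j <- s | P j) lbr (F j) h.
  by apply: (big_morph (fun u => lbr u h)) => [u v|]; rewrite ?lbrDl ?lbr0l.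
have lbr_sumr J (s : seq J) (P : pred J) (F : J -> L) h :
    lbr h (\sum_(j <- s | P j) F j) = \sum_(j <- s | P j) lbr h (F j).
  by apply: (big_morph (lbr h)) => [u v|]; rewrite ?lbrDr ?lbr0r.
rewrite lbr_suml lval_sum; apply: eq_bigr => i _.
by rewrite lbr_sumr lval_sum.
Qed.

(* Up to the factor k`!, the left-hand side is the expansion of (1 - 1) ^+ k. *)
Lemma exp_coef_inv k :
  \sum_(i < k.+1) ((i`!)%:R^-1 * ((-1) ^+ (k - i) * ((k - i)`!)%:R^-1)) =
  (k == 0%N)%:R :> K.
Proof.
apply: (mulrI (fact_unit k)).
transitivity ((k == 0%N)%:R : K); last by case: k => [|k]; rewrite ?mulr1 ?mulr0.
rewrite -expr0n -[X in _ = X ^+ k](addNr 1) exprDn mulr_sumr; apply: eq_bigr => i _.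
have ik : (i <= k)%N by rewrite -ltnS.
rewrite expr1n mulr1 -[RHS]mulr_natr -(bin_fact ik) !natrM.
set c : K := ('C(k, i))%:R; set s := _ ^+ _.
have -> : c * ((i`!)%:R * ((k - i)`!)%:R) * ((i`!)%:R^-1 * (s * ((k - i)`!)%:R^-1)) =
  c * s * ((i`!)%:R / (i`!)%:R) * (((k - i)`!)%:R / ((k - i)`!)%:R) by ring.
by rewrite !divrr ?fact_unit // !mulr1 mulrC.
Qed.

Lemma iterN X k f : endo X -> iter k (- X) f = (-1) ^+ k *: iter k X f.
Proof.
move=> eX; elim: k => [|k IH]; first by rewrite expr0 scale1r.
rewrite !iterS IH; change (- X ((-1) ^+ k *: iter k X f) = (-1) ^+ k.+1 *: X (iter k X f)).
by rewrite (endoZ _ _ eX) exprS -scalerA scaleN1r.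
Qed.

Lemma expableN X : expable X -> expable (- X).
Proof.
move=> [eX dX rX]; split; [exact: endo_opp| |exact: raisesN].
by move=> p f fp w; apply/grN/dX.
Qed.

(** Collecting the double sum by total exponent k gives X^k the coefficient computed in
    [exp_coef_inv], which vanishes unless k = 0. *)
Lemma vexpNK X : expable X -> cancel (vexp (- X)) (vexp X).
Proof.
move=> xX f; have [eX dX rX] := xX; have xN := expableN xX.
apply: lhat_ext => w; pose N := (size w).+1; rewrite (vexpE _ xX (leqnSn _)) -/N.
pose a i j : K := lval (exp_term X i (exp_term (- X) j f)) w.
have aE i j : a i j = (i`!)%:R^-1 * ((-1) ^+ j * (j`!)%:R^-1) * lval (iter (i + j) X f) w.
  rewrite /a /exp_term iterN // scalerA lvalZ (endoZ _ _ (endo_iter i eX)) lvalZ.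
  by rewrite -iterD mulrA [(j`!)%:R^-1 * _]mulrC.
transitivity (\sum_(i < N) \sum_(j < N) a i j).
  apply: eq_bigr => i _; have eT := exp_term_endo i eX.
  rewrite -lval_sum -(endo_sum _ _ _ eT).
  apply: (@zero_belowE N) => //; rewrite -(endoB _ _ eT).
  apply: (@zero_below_leq (N + i * 1)); first by lia.
  by apply: exp_term_raises => //; apply: zero_below_vexpB.
rewrite triangle_sum_trunc => [|i j ij]; last first.
  rewrite aE (raises_iter (k := i + j) rX (@zero_below1 f)) ?mulr0 //.
  by rewrite /N in ij; lia.
transitivity (\sum_(k < N) ((k : nat) == 0%N)%:R * (lval (iter k X f) w : K)).
  apply: eq_bigr => k _; rewrite -exp_coef_inv mulr_suml; apply: eq_bigr => i _.
  by rewrite aE subnKC // -ltnS.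
rewrite big_ord_recl /= mul1r big1 ?addr0 // => k _.
by rewrite /bump mul0r.
Qed.

Lemma vexpKN X : expable X -> cancel (vexp X) (vexp (- X)).
Proof. by move=> xX; have := vexpNK (expableN xX); rewrite opprK. Qed.

Lemma vfieldN X : vfield 0 X -> vfield 0 (- X).
Proof. by rewrite -sub0r; apply/vfieldB/vfield0. Qed.

Lemma vexp_diffeo X : vfield 0 X -> raises 1 X -> diffeo (vexp X).
Proof.
move=> vX rX; have [eX dX _] := vX; have xX : expable X by split.
have hom Y : vfield 0 Y -> raises 1 Y -> lie_hom (vexp Y).
  move=> vY rY; have [eY dY _] := vY; have xY : expable Y by split.
  split; [exact: vexp_endo|exact: vexp_degree|].
  by move=> f g; apply: vexp_lbr.
split; first exact: hom.
exists (vexp (- X)); split; [|exact: vexpKN|exact: vexpNK].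
by apply: hom; [apply: vfieldN|apply: raisesN].
Qed.

Lemma diffeo_comp X Y : diffeo X -> diffeo Y -> diffeo (X \o Y).
Proof.
have hom Z W : lie_hom Z -> lie_hom W -> lie_hom (Z \o W).
  move=> [eZ dZ hZ] [eW dW hW]; split; first exact: endo_comp.
    by move=> p f /dW/dZ; rewrite !addr0.
  by move=> f g; rewrite /= hW hZ.
move=> [hX [X' [hX' KX XK]]] [hY [Y' [hY' KY YK]]]; split; first exact: hom.
by exists (Y' \o X'); split; [exact: hom|exact: can_comp|exact: can_comp].
Qed.

(** * Orders of pointed maps, brackets and structures *)

Lemma pointed_raises X : endo X -> pointed X -> raises 1 (X - id).
Proof.
move=> eX [ph [phP XE]]; have /order_geP[] // : order_ge 2 (X - id).
split=> [|i f fi w wi]; first exact/endo_sub/endo_id.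
change (lval (X f - f) w = 0); rewrite lvalB.
have [N /(_ N (leqnn _)) <-] := XE f w.
rewrite lvalD lval_sum big_nat_cond big1 ?addr0 ?subrr // => j.
rewrite andbT => /andP[j2 _]; have [_ oj] := phP j j2.
by apply: (oj _ _ fi); lia.
Qed.

Lemma has_order_comp i j X Y :
  has_order i X -> has_order j.+1 Y -> has_order (i + j) (X \o Y).
Proof.
move=> oX oY a f fa w wa; apply: (oX (a + j)%N); last by lia.
by move=> u ua; apply: (oY _ _ fa); lia.
Qed.

Lemma has_order_scale i k X : has_order i X -> has_order i (k *: X).
Proof.
move=> oX a f fa w wa; change (k * (lval (X f) w : K) = 0).
by rewrite (oX _ _ fa) // mulr0.
Qed.

Lemma has_degree_comp p q X Y :
  has_degree p X -> has_degree q Y -> has_degree (p + q) (X \o Y).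
Proof. by move=> dX dY r f /dY/dX; rewrite -addrA [q + p]addrC. Qed.

Lemma endo_gcomm d e X Y : endo X -> endo Y -> endo (gcomm d e X Y).
Proof.
by move=> eX eY; apply: endo_sub; [|apply: endo_scale]; apply: endo_comp.
Qed.

(** Here j may be 0, as happens for eta when n = 3: convergence of exp [m, eta] is ensured by m,
    which raises by 1. *)
Lemma gcomm_expable X Y j : endo X -> has_degree 1 X -> raises 1 X ->
  vfield (-1) Y -> raises j Y -> expable (gcomm 1 (-1) X Y).
Proof.
move=> eX dX rX [eY dY _] rY; split; first exact: endo_gcomm.
  move=> p f fp w; apply: grB.
    by have := has_degree_comp dX dY fp w; rewrite subrr.
  have h := has_degree_comp dY dX fp w; rewrite addNr in h.
  exact: (gr_sign (1 * -1) h).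
apply: raisesB; first exact: (raises_leq (leq_addr j 1) (raises_comp rX rY)).
move=> M f f0; apply: zero_belowZ.
exact: (raises_leq (leq_addl j 1) (raises_comp rY rX)).
Qed.

Lemma gcomm_raises d e X Y i j : raises i X -> raises j Y ->
  raises (i + j) (gcomm d e X Y).
Proof.
move=> rX rY; apply: raisesB; first exact: raises_comp.
by move=> M f f0; apply: zero_belowZ; rewrite [(i + j)%N]addnC; apply: raises_comp f0.
Qed.

Lemma gcomm_order d e X Y i j : has_order i.+1 X -> has_order j.+1 Y ->
  has_order (i + j).+1 (gcomm d e X Y).
Proof.
move=> oX oY; apply: has_orderB; first by rewrite -addSn; apply: has_order_comp.
by apply: has_order_scale; rewrite addnC -addSn; apply: has_order_comp.
Qed.

Lemma gcommBl d e X X' Y : endo Y ->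
  gcomm d e X Y - gcomm d e X' Y = gcomm d e (X - X') Y.
Proof.
move=> eY; apply/funext => f.
change (X (Y f) - (koszul (d * e) : K) *: Y (X f) -
    (X' (Y f) - (koszul (d * e) : K) *: Y (X' f)) =
  X (Y f) - X' (Y f) - (koszul (d * e) : K) *: Y (X f - X' f)).
rewrite (endoB _ _ eY) scalerBr !opprB addrACA [RHS]addrACA; congr (_ + _).
by rewrite addrC.
Qed.

(** Each m_i raises by i - 1, so replacing m by m_2 in a composition gains one more in length. *)
Lemma tot_raises n (m : nat -> End) : (1 < n)%N -> minC n.+1 m ->
  [/\ endo (tot n.+1 m), has_degree 1 (tot n.+1 m), raises 1 (tot n.+1 m)
    & raises 2 (tot n.+1 m - m 2%N)].
Proof.
move=> n1 [mP _]; rewrite /tot big_ltn //; set T := \sum_(3 <= i < n.+1) m i.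
have [[e2 d2 _] o2] := mP 2%N n1.
have [eT dT rT] : [/\ endo T, has_degree 1 T & raises 2 T].
  rewrite /T big_nat_cond; elim/big_rec: _ => [|i X].
    by split; [exact: endo_zero|move=> p f _ w; apply: gr0|].
  rewrite andbT => /andP[i3 iN] [eX dX rX].
  have [|[ei di _] oi] := mP i; first by lia.
  split; first exact: endo_add.
    by move=> p f fp w; apply: grD; [apply: di|apply: dX].
  apply: raisesD => //; apply: (@raises_leq _ i.-1); first by lia.
  by apply: has_order_raises => //; rewrite prednK //; lia.
have r2 : raises 1 (m 2%N) by apply: has_order_raises.
split; [exact: endo_add| |by apply: raisesD => //; apply: raises_leq rT|].
  by move=> p f fp w; apply: grD; [apply: d2|apply: dT].
by rewrite addrC addKr.
Qed.

(** * Extensions and equivalences modulo higher order *)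

Section Criteria.
Variables (A : scAlgebra G dg) (n : nat) (m m' : nat -> End) (phi : End).
Hypotheses (hn : (3 <= n)%N) (hm : minC n.+1 m) (hm' : minC n.+1 m').
Hypotheses (mA : m 2%N = A) (m'A : m' 2%N = A).
Hypotheses (phi_diffeo : diffeo phi) (phi_pointed : pointed phi).

Let M := tot n.+1 m.
Let M' := tot n.+1 m'.
Let ephi : endo phi := let: conj (And3 e _ _) _ := phi_diffeo in e.
Let eA : endo A := let: And3 e _ _ := mul2_vfield A in e.

Let rphi : raises 1 (phi - id).
Proof. exact: pointed_raises. Qed.

Lemma raises_near_id X : raises 1 (X - id) -> raises 0 X.
Proof.
move=> rX; have -> : X = (X - id) + id by rewrite subrK.
by apply: raisesD; [apply: raises_leq rX|move=> N f; rewrite addn0].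
Qed.

Let rphi0 : raises 0 phi.
Proof. exact: raises_near_id. Qed.

Section OneField.
Variable gamma : End.
Hypotheses (vg : vfield 0 gamma) (og : has_order n.-1 gamma).

Lemma order_field_raises : raises (n - 2) gamma.
Proof.
have [eg _ _] := vg; apply: has_order_raises => //.
by have -> : (n - 2).+1 = n.-1 by lia.
Qed.

Lemma order_field_expable : expable gamma.
Proof.
have [eg dg' _] := vg; split=> //.
by apply: raises_leq order_field_raises; lia.
Qed.

Lemma vexp_order_field_raises : raises n.-1 (vexp gamma - id - gamma).
Proof.
apply: (@raises_leq _ (2 * (n - 2))); first by lia.
by apply: vexp_raises2; [exact: order_field_expable|exact: order_field_raises].
Qed.

Lemma is_extensionP : is_extension n m m' phi gamma <->
  raises n ((phi \o M) - (M' \o phi) + ((gamma \o A) - (A \o gamma))).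
Proof.
have [eg dg' _] := vg; have rg := order_field_raises; have rE := vexp_order_field_raises.
have xg := order_field_expable; have [_ _ r1] := xg.
have [eM _ rM rMA] := tot_raises (ltnW hn) hm.
have [eM' _ rM' rMA'] := tot_raises (ltnW hn) hm'.
rewrite -/M mA in eM rM rMA; rewrite -/M' m'A in eM' rM' rMA'.
set Q := (X in raises n X); set E := vexp gamma in rE *.
have eE : endo E by apply: vexp_endo.
pose R := E - id - gamma; pose P := phi - id.
(* Each correction raises by at least n: R counts n - 1, gamma n - 2, P and M and M' count 1, the
   differences with A count 2, and phi counts 0. *)
have DE : ((E \o phi) \o M) - (M' \o (E \o phi)) =
    Q + ((R \o (phi \o M)) + (gamma \o (P \o M)) + (gamma \o (M - mul2 A))
      - ((M' \o (R \o phi)) + (M' \o (gamma \o P)) + ((M' - mul2 A) \o gamma))).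
  apply/funext => f; rewrite /Q /R /P.
  change (E (phi (M f)) - M' (E (phi f)) =
    phi (M f) - M' (phi f) + (gamma (A f) - A (gamma f)) +
    ((E (phi (M f)) - phi (M f) - gamma (phi (M f))) + gamma (phi (M f) - M f) +
     gamma (M f - A f) -
     (M' (E (phi f) - phi f - gamma (phi f)) + M' (gamma (phi f - f)) +
      (M' (gamma f) - A (gamma f))))).
  rewrite !(endoB _ _ eg) !(endoB _ _ eM').
  (* [lhat] is only a module, so the identity is checked on coefficients in [K]. *)
  apply: lhat_ext => w; rewrite !(lvalB, lvalD); ring.
have rP : raises 1 P by [].
have rD : raises n (((E \o phi) \o M) - (M' \o (E \o phi)) - Q).
  rewrite DE addrC addKr; apply: raisesB.
    apply: raisesD; [apply: raisesD|].
    - by apply: raises_leq (raises_comp rE (raises_comp rphi0 rM)); lia.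
    - by apply: raises_leq (raises_comp rg (raises_comp rP rM)); lia.
    - by apply: raises_leq (raises_comp rg rMA); lia.
  apply: raisesD; [apply: raisesD|].
  - by apply: raises_leq (raises_comp rM' (raises_comp rE rphi0)); lia.
  - by apply: raises_leq (raises_comp rM' (raises_comp rg rP)); lia.
  - by apply: raises_leq (raises_comp rMA' rg); lia.
split=> [[_ _ [_ _ /order_geP[_ r]]]|rQ].
  by have := raisesB r rD; rewrite opprB addrC subrK.
have dE : diffeo (E \o phi) by apply/diffeo_comp/phi_diffeo/vexp_diffeo.
split=> //; split=> //; first by have [[]] := dE.
apply/order_geP; split; last by have := raisesD rD rQ; rewrite subrK.
have eEp := endo_comp eE ephi.
exact: endo_sub (endo_comp eEp eM) (endo_comp eM' eEp).
Qed.

End OneField.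

Lemma ext_equivP gamma gamma' :
  vfield 0 gamma -> has_order n.-1 gamma -> vfield 0 gamma' -> has_order n.-1 gamma' ->
  ext_equiv n m phi gamma gamma' <->
  exists eta, [/\ vfield (-1) eta, has_order n.-2 eta &
    gamma - gamma' = gcomm 1 (-1) A eta].
Proof.
move=> vg og vg' og'.
suff crit eta : vfield (-1) eta -> has_order n.-2 eta ->
    eqmod n (vexp gamma \o phi) (vexp gamma' \o phi \o vexp (gcomm 1 (-1) M eta)) <->
    gamma - gamma' = gcomm 1 (-1) A eta.
  by split=> -[eta [veta oeta /crit c]]; exists eta; split=> //; apply: c.
move=> veta oeta; have [eg _ _] := vg; have [eg' _ _] := vg'; have [ee _ _] := veta.
have rg := order_field_raises vg og; have rR := vexp_order_field_raises vg og.
have rg' := order_field_raises vg' og'; have rR' := vexp_order_field_raises vg' og'.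
have reta : raises (n - 3) eta.
  apply: has_order_raises => //.
  by have -> : (n - 3).+1 = n.-2 by lia.
have [eM dM rM rMA] := tot_raises (ltnW hn) hm; rewrite -/M mA in eM dM rM rMA.
have xD := gcomm_expable eM dM rM veta reta.
have rD : raises (n - 2) (gcomm 1 (-1) M eta).
  by apply: (@raises_leq _ (1 + (n - 3))); [lia|exact: gcomm_raises].
set D := gcomm 1 (-1) M eta in xD rD *; pose DA := gcomm 1 (-1) A eta.
(* The difference is [m - m_2, eta], which raises by 2 + (n - 3). *)
have rDA : raises n.-1 (D - DA).
  rewrite gcommBl //; apply: (@raises_leq _ (2 + (n - 3))); first by lia.
  exact: gcomm_raises.
have rF := vexp_raises1 xD rD.
have rF2 : raises n.-1 (vexp D - id - D).
  by apply: (@raises_leq _ (2 * (n - 2))); [lia|exact: vexp_raises2].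
have eE := vexp_endo (order_field_expable vg og).
have eE' := vexp_endo (order_field_expable vg' og').
have eF := vexp_endo xD.
set E := vexp gamma in rR eE *; set E' := vexp gamma' in rR' eE' *.
set F := vexp D in rF rF2 eF *.
have rF0 : raises 0 F by apply/raises_near_id/(raises_leq _ rF); lia.
pose R := E - id - gamma; pose R' := E' - id - gamma'; pose P := phi - id.
(* Equality modulo (n) means a raise of n - 1. Here gamma, gamma' and F - id count n - 2, P counts
   1, while R, R', F - id - D and D - DA already reach n - 1. *)
have DE : (E \o phi) - ((E' \o phi) \o F) =
    (gamma - gamma' - DA) + ((R \o phi) + (gamma \o P) - (R' \o (phi \o F))
      - (P \o (F - id)) - (F - id - D) - (D - DA)
      - (gamma' \o (P \o F)) - (gamma' \o (F - id))).
  apply/funext => f; rewrite /R /R' /P.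
  change (E (phi f) - E' (phi (F f)) =
    gamma f - gamma' f - DA f +
    ((E (phi f) - phi f - gamma (phi f)) + gamma (phi f - f)
     - (E' (phi (F f)) - phi (F f) - gamma' (phi (F f)))
     - (phi (F f - f) - (F f - f)) - (F f - f - D f) - (D f - DA f)
     - gamma' (phi (F f) - F f) - gamma' (F f - f))).
  rewrite !(endoB _ _ eg) !(endoB _ _ eg') (endoB _ _ ephi).
  move: (E (phi f)) (E' (phi (F f))) (gamma f) (gamma' f) (DA f) (phi f).
  move: (gamma (phi f)) (gamma' (phi (F f))) (phi (F f)) (F f) (D f) (gamma' (F f)).
  by move=> *; apply: lhat_ext => w; rewrite !(lvalB, lvalD); ring.
have rT : raises n.-1 ((E \o phi) - ((E' \o phi) \o F) - (gamma - gamma' - DA)).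
  have rP : raises 1 P by [].
  have r1 : raises n.-1 (R \o phi).
    by apply: raises_leq (raises_comp rR rphi0); lia.
  have r2 : raises n.-1 (gamma \o P).
    by apply: raises_leq (raises_comp rg rP); lia.
  have r3 : raises n.-1 (R' \o (phi \o F)).
    by apply: raises_leq (raises_comp rR' (raises_comp rphi0 rF0)); lia.
  have r4 : raises n.-1 (P \o (F - id)).
    by apply: raises_leq (raises_comp rP rF); lia.
  have r5 : raises n.-1 (gamma' \o (P \o F)).
    by apply: raises_leq (raises_comp rg' (raises_comp rP rF0)); lia.
  have r6 : raises n.-1 (gamma' \o (F - id)).
    by apply: raises_leq (raises_comp rg' rF); lia.
  rewrite DE addrC addKr.
  have r7 := raisesB (raisesB (raisesD r1 r2) r3) r4.
  exact: raisesB (raisesB (raisesB (raisesB r7 rF2) rDA) r5) r6.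
have nE : n = n.-1.+1 by lia.
rewrite /eqmod {1}nE; split=> [/order_geP[_ r]|gE].
  apply/eqP; rewrite -subr_eq0; apply/eqP/(@has_order_eq0 n.-1).
  - exact: endo_sub (endo_sub eg eg') (endo_gcomm _ _ eA ee).
  - apply: has_orderB; first exact: has_orderB.
    have -> : n.-1 = (1 + (n - 3)).+1 by lia.
    apply: gcomm_order; first exact: mul2_order.
    by have -> : (n - 3).+1 = n.-2 by lia.
  - by have := raisesB r rT; rewrite opprB addrC subrK.
apply/order_geP; split.
  exact: endo_sub (endo_comp eE ephi) (endo_comp (endo_comp eE' ephi) eF).
by move: rT; rewrite -/DA in gE; rewrite gE subrr subr0.
Qed.

(** Subtracting the two affine conditions of [is_extensionP] cancels the phi terms and leaves the
    bracket of gamma' - gamma with m_2. It has pure order n, so being in (n + 1) forces it to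
    vanish. *)
Lemma extension_cocycleP gamma gamma' :
  is_extension n m m' phi gamma -> vfield 0 gamma' -> has_order n.-1 gamma' ->
  is_extension n m m' phi gamma' <-> harr_diff A 1 (gamma' - gamma) = 0.
Proof.
move=> xg vg' og'; have [vg og _] := xg; have [eg _ _] := vg; have [eg' _ _] := vg'.
pose B X : End := (X \o A) - (A \o X).
(* Second index 1 means degree 0 as a vector field, so the Koszul sign is trivial. *)
have HB X : harr_diff A 1 X = - B X.
  rewrite /harr_diff /gcomm subrr mulr0 /koszul expr0 scale1r opprB.
  by [].
have BB : B (gamma' - gamma) = B gamma' - B gamma.
  apply/funext => f; rewrite /B.
  change (gamma' (A f) - gamma (A f) - A (gamma' f - gamma f) =
    gamma' (A f) - A (gamma' f) - (gamma (A f) - A (gamma f))).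
  rewrite (endoB _ _ eA); apply: lhat_ext => w; rewrite !(lvalB, lvalD); ring.
have /is_extensionP := xg => /(_ vg og) rg.
rewrite HB (is_extensionP vg' og'); split=> [rg'|/eqP].
  suff -> : B (gamma' - gamma) = 0 by rewrite oppr0.
  apply: (@has_order_eq0 n).
  - exact: endo_sub (endo_comp (endo_sub eg' eg) eA) (endo_comp eA (endo_sub eg' eg)).
  - have oB : has_order n.-1 (gamma' - gamma) by apply: has_orderB.
    apply: has_orderB.
      have -> : n = (n.-1 + 1)%N by lia.
      by apply: has_order_comp => //; apply: mul2_order.
    have -> : n = (2 + (n - 2))%N by lia.
    apply: has_order_comp; first exact: mul2_order.
    by have -> : (n - 2).+1 = n.-1 by lia.
  - rewrite BB; have := raisesB rg' rg.
    by rewrite opprD addrACA subrr add0r.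
rewrite oppr_eq0 BB subr_eq0 => /eqP BE.
by move: rg; rewrite -/(B gamma) -/(B gamma') BE.
Qed.

End Criteria.
End LieSeriesFacts.

(** * The action of Harrison cohomology *)

Section HarrisonAction.
Context {K : comUnitRingType} (G : evenGrading K) {I : choiceType}.
Variables (dg : I -> int) (A : scAlgebra G dg) (n : nat).
Local Notation End := (lhat G dg -> lhat G dg).
Implicit Types X Y : End.

(** Stated for bare endomorphisms, so that it applies both to cocycles and to differences of
    extensions. *)
Definition coboundary X := exists eta,
  [/\ vfield (-1) eta, has_order n.-2 eta & X = gcomm 1 (-1) A eta].

Lemma coboundary0 : coboundary 0.
Proof.
exists 0; split; [exact: vfield0|by move=> *|].
by rewrite -[X in gcomm _ _ _ X](subrr 0) gcommB subrr.
Qed.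

Lemma coboundaryB X Y : coboundary X -> coboundary Y -> coboundary (X - Y).
Proof.
move=> [e [ve oe ->]] [e' [ve' oe' ->]]; exists (e - e').
by split; [exact: vfieldB|exact: has_orderB|rewrite gcommB].
Qed.

Lemma coboundaryN X : coboundary X -> coboundary (- X).
Proof. by rewrite -sub0r; apply/coboundaryB/coboundary0. Qed.

Lemma coboundaryD X Y : coboundary X -> coboundary Y -> coboundary (X + Y).
Proof. by move=> cX cY; rewrite -[Y]opprK; apply/coboundaryB/coboundaryN. Qed.

Lemma hclassP (xi xi' : cocycle A n.-1 1) :
  hclass xi = hclass xi' <-> coboundary (cval xi - cval xi').
Proof.
have -> : hclass xi = hclass xi' <-> (xi - xi') \in @coboundary_pred _ _ _ _ A n.-1 1.
  by rewrite Quotient.idealrBE; split=> [/eqP|/eqP].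
rewrite inE -[cval xi - cval xi'](raddfB val) /=; split.
  by move=> [eta [[ve oe] xE]]; exists eta; split.
by move=> [eta [ve oe xE]]; exists eta; split.
Qed.

Lemma hclassD (xi xi' : cocycle A n.-1 1) : hclass (xi + xi') = hclass xi + hclass xi'.
Proof. exact: raddfD. Qed.

Lemma hclass0 : hclass (0 : cocycle A n.-1 1) = 0.
Proof. exact: raddf0. Qed.

Lemma hclass_surj (a : HHarr A n.-1 1) : exists xi, hclass xi = a.
Proof. by exists (repr a); rewrite /hclass reprK. Qed.

Variables (m m' : nat -> End) (phi : End).
Hypotheses (hn : (3 <= n)%N) (hm : minC n.+1 m) (hm' : minC n.+1 m').
Hypotheses (mA : m 2%N = A) (m'A : m' 2%N = A).
Hypotheses (phi_diffeo : diffeo phi) (phi_pointed : pointed phi).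
Implicit Types gamma : extension n m m' phi.

Lemma ext_equiv_coboundary gamma gamma' :
  ext_equiv n m phi (sval gamma) (sval gamma') <-> coboundary (sval gamma - sval gamma').
Proof.
have [v o _] := svalP gamma; have [v' o' _] := svalP gamma'.
exact: ext_equivP.
Qed.

(** That [ext_equiv] is an equivalence relation is read off from the coboundaries being a
    subgroup. *)
Lemma eclassP gamma gamma' :
  eclass gamma = eclass gamma' <-> coboundary (sval gamma - sval gamma').
Proof.
split=> [/(congr1 sval)/= E|c].
  apply/ext_equiv_coboundary.
  have : [set y : extension n m m' phi |
      ext_equiv n m phi (sval y) (sval gamma)]%classic gamma.
    by apply/ext_equiv_coboundary; rewrite subrr; apply: coboundary0.
  by rewrite E.
apply: eq_exist; apply/seteqP; split=> x /= /ext_equiv_coboundary cx;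
  apply/ext_equiv_coboundary.
  by have := coboundaryD cx c; rewrite addrA subrK.
by have := coboundaryB cx c; rewrite opprB addrA subrK.
Qed.

Lemma eclass_surj (x : EMn n m m' phi) : exists gamma, eclass gamma = x.
Proof. by case: x => C [gamma CE]; exists gamma; apply: eq_exist. Qed.

Lemma extension_add_cocycle gamma (xi : cocycle A n.-1 1) :
  is_extension n m m' phi (sval gamma + cval xi).
Proof.
have xg := svalP gamma; have [v o _] := xg.
have /asboolP[[vx ox] dx] := valP xi; rewrite subrr in vx.
apply/(extension_cocycleP hn hm hm' mA m'A phi_diffeo phi_pointed xg).
- by rewrite -[cval xi]opprK; apply/vfieldB/vfieldN.
- rewrite -[cval xi]opprK; apply: has_orderB => //; rewrite -sub0r.
  by apply: has_orderB => // a f _ w _.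
- by rewrite addrC addKr.
Qed.

Definition shift_extension gamma (xi : cocycle A n.-1 1) : extension n m m' phi :=
  exist _ _ (extension_add_cocycle gamma xi).

Lemma extensionB_cocycle gamma gamma' :
  exists xi : cocycle A n.-1 1, cval xi = sval gamma' - sval gamma.
Proof.
have xg := svalP gamma; have [v o _] := xg.
have xg' := svalP gamma'; have [v' o' _] := xg'.
have c : sval gamma' - sval gamma \in cocycle_pred A n.-1 1.
  apply/asboolP; split.
    by split; [rewrite subrr; apply: vfieldB|apply: has_orderB].
  by apply/(extension_cocycleP hn hm hm' mA m'A phi_diffeo phi_pointed xg v' o').
by exists (Cocycle c).
Qed.

Definition harr_act (a : HHarr A n.-1 1) (x : EMn n m m' phi) : EMn n m m' phi :=
  eclass (shift_extension (sval (cid (eclass_surj x))) (sval (cid (hclass_surj a)))).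

(** Independence of the representatives chosen by [cid]: changing either one alters the sum by a
    coboundary. *)
Lemma harr_actE xi gamma :
  harr_act (hclass xi) (eclass gamma) = eclass (shift_extension gamma xi).
Proof.
rewrite /harr_act; case: cid => g /= /eclassP cg; case: cid => x /= /hclassP cx.
apply/eclassP; rewrite /= opprD addrACA.
exact: coboundaryD.
Qed.

End HarrisonAction.

Theorem theorem9p20 (K : comUnitRingType) (G : evenGrading K)
    (I : choiceType) (dg : I -> int) (A : scAlgebra G dg) (n : nat)
    (m m' : nat -> lhat G dg -> lhat G dg) (hn : (3 <= n)%N)
    (hm : minC n.+1 m) (hm' : minC n.+1 m')
    (mA : m 2%N = A) (m'A : m' 2%N = A)
    (c : Mn n m m') (phi : pmor n m m') (phi_c : sval c phi)
    (phi_ext : extendable n m m' (sval phi)) :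
  exists act : HHarr A n.-1 1 -> EMn n m m' (sval phi) -> EMn n m m' (sval phi),
    [/\ is_action act,
        forall (xi : cocycle A n.-1 1) (gamma : extension n m m' (sval phi)),
          exists gamma' : extension n m m' (sval phi),
            sval gamma' = sval gamma + cval xi /\
            act (hclass xi) (eclass gamma) = eclass gamma',
        free_action act
      & transitive_action act].
Proof.
have [phi_p [phi_d _ _]] := svalP phi.
have eP := @eclassP _ _ _ _ A _ _ _ _ hn hm mA phi_d phi_p.
pose act := harr_act hn hm hm' mA m'A phi_d phi_p.
have actE xi gamma : act (hclass xi) (eclass gamma) = _ := harr_actE _ _ _ _ _ _ _ xi gamma.
exists act; split.
- split=> [x|a b x]; have [gamma <-] := eclass_surj x.
    rewrite -hclass0 actE; apply/eP => /=.
    by rewrite addr0 subrr; apply: coboundary0.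
  have [xi <-] := hclass_surj a; have [xi' <-] := hclass_surj b.
  rewrite -hclassD !actE; apply/eP => /=.
  by rewrite [cval xi + cval xi']addrC addrA subrr; apply: coboundary0.
- by move=> xi gamma; exists (shift_extension hn hm hm' mA m'A phi_d phi_p gamma xi).
- move=> a x; have [gamma <-] := eclass_surj x; have [xi <-] := hclass_surj a.
  rewrite actE => /eP /=; rewrite addrC addKr => cx.
  by rewrite -hclass0; apply/hclassP; rewrite subr0.
split=> [|x y].
  (* Extendability provides the point that [transitive_action] demands. *)
  by have [gamma xg] := phi_ext; exact: inhabits (eclass (exist _ gamma xg)).
have [gamma <-] := eclass_surj x; have [gamma' <-] := eclass_surj y.
have [xi xiE] := extensionB_cocycle hn hm hm' mA m'A phi_d phi_p gamma gamma'.
exists (hclass xi); rewrite actE; apply/eP => /=.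
by rewrite xiE addrCA subrr addr0 subrr; apply: coboundary0.
Qed.
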